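(* For $|q|<1$ (equivalently, as formal power series in $q$), $$\frac{f_1^2 f_6}{f_2 f_3^2}+\frac{f_2^2 f_{12}}{f_4 f_6^2}=2\,\frac{f_1 f_{16} f_{24}^2}{f_3 f_6 f_8 f_{48}}.$$
   Context: For a positive integer $n$, $f_n:=(q^n;q^n)_\infty=\prod_{j=1}^\infty(1-q^{nj})$. *)

(* Defs.v *)
From mathcomp Require Import all_boot all_order all_algebra.
From mathcomp Require Import all_classical all_reals all_analysis.
Set Implicit Arguments.
Unset Strict Implicit.
Unset Printing Implicit Defensive.
Import Order.TTheory GRing.Theory Num.Theory.
Import numFieldNormedType.Exports.
Local Open Scope classical_set_scope.
Local Open Scope ring_scope.

(* (a; q)_oo = \prod_(k >= 0) (1 - a q^k), as the limit of its partial products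
   in the topology of the norm of K; the limit exists as soon as `|q| < 1 when
   K is complete, e.g. K = R[i] with R a realType. *)
Definition qpochhammer_inf (K : numFieldType) (a q : K) : K :=
  lim ((fun N : nat => \prod_(0 <= k < N) (1 - a * q ^+ k)) @ \oo).

Definition f (K : numFieldType) (q : K) (n : nat) : K :=
  qpochhammer_inf (q ^+ n) (q ^+ n).

(* Main.v *)
(* Write phi(q) for the sum of q^(n^2) over all integers n, and psi for the half-sided
   sum over triangular exponents, so that phi(-q) = f_1^2 / f_2 and psi(q) = f_2^2 / f_1
   by the Jacobi triple product. The claim becomes the product formula
     phi(-q) phi(-q^6) + phi(-q^2) phi(-q^3) = 2 f_1 f_3 f_16 f_24^2 / (f_8 f_12 f_48).
   It follows, by four extractions of a square root in the domain of formal power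
   series (the sign is read off the constant term), from
     phi(q) = phi(q^4) + 2 q psi(q^8),
     phi(q) phi(q^3) - phi(-q) phi(-q^3) = 4 q psi(q^2) psi(q^6).
   With A(q) = phi(q) phi(q^3) and B(q) = A(-q), the successive square roots give
   the modulus (alpha^3 / beta)^(1/8) as an eta quotient, then product formulas for
   2 A(q^2) - B(q^2) + B(q), for B(q^2) + B(q), and for the sum above.
   A polynomial relation between the series f_n passes to complex q because the same
   relation between the partial products has no terms of low degree, while its
   coefficients are dominated by those of a polynomial that is bounded at some radius
   larger than |q|. *)
Require Import Defs.
From HB Require Import structures.
From mathcomp Require Import all_boot all_order all_algebra.
From mathcomp Require Import all_classical all_reals all_analysis.
From mathcomp Require Import complex fraction ring lra zify.
Set Implicit Arguments.
Unset Strict Implicit.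
Unset Printing Implicit Defensive.
Import Order.TTheory GRing.Theory Num.Theory.
Import numFieldNormedType.Exports.
Local Open Scope ring_scope.
Local Open Scope complex_scope.

(** * Formal power series *)

Definition fps (R : Type) := nat -> R.

HB.instance Definition _ (R : choiceType) := Choice.copy (fps R) (nat -> R).

Lemma fpsP (R : Type) (a b : fps R) : (forall n, a n = b n) -> a = b.
Proof. exact: funext. Qed.

Section FpsRing.
Variable R : comNzRingType.
Implicit Types a b c : fps R.

Definition fps0 : fps R := fun=> 0.
Definition fpsN a : fps R := fun n => - a n.
Definition fpsD a b : fps R := fun n => a n + b n.

Lemma fpsDA : associative fpsD.
Proof. by move=> a b c; apply: fpsP => n; exact: addrA. Qed.
Lemma fpsDC : commutative fpsD.
Proof. by move=> a b; apply: fpsP => n; exact: addrC. Qed.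
Lemma fps0D : left_id fps0 fpsD.
Proof. by move=> a; apply: fpsP => n; exact: add0r. Qed.
Lemma fpsND : left_inverse fps0 fpsN fpsD.
Proof. by move=> a; apply: fpsP => n; exact: addNr. Qed.

HB.instance Definition _ := GRing.isZmodule.Build (fps R) fpsDA fpsDC fps0D fpsND.

Definition fps_trunc n a : {poly R} := \poly_(i < n) a i.

Lemma coef_trunc n a i : (i < n)%N -> (fps_trunc n a)`_i = a i.
Proof. by move=> lin; rewrite coef_poly lin. Qed.

Definition fps1 : fps R := fun n => (n == 0%N)%:R.
Definition fpsM a b : fps R := fun n => \sum_(i < n.+1) a i * b (n - i)%N.

(** A coefficient of a product involves finitely many coefficients of the factors, so associativity
    and commutativity of [fpsM] are inherited from [{poly R}]. *)
Lemma fpsM_trunc n a b i : (i < n)%N -> fpsM a b i = (fps_trunc n a * fps_trunc n b)`_i.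
Proof.
move=> lin; rewrite coefM; apply: eq_bigr => j _.
by rewrite !coef_trunc //; have := ltn_ord j; lia.
Qed.

Lemma fpsMA : associative fpsM.
Proof.
move=> a b c; apply: fpsP => n.
transitivity ((fps_trunc n.+1 a * fps_trunc n.+1 b * fps_trunc n.+1 c)`_n).
  rewrite -mulrA coefM; apply: eq_bigr => j _.
  by rewrite coef_trunc // (@fpsM_trunc n.+1) //; lia.
rewrite coefM; apply: eq_bigr => j _.
by rewrite coef_trunc ?(@fpsM_trunc n.+1) //; lia.
Qed.

Lemma fpsMC : commutative fpsM.
Proof. by move=> a b; apply: fpsP => n; rewrite !(@fpsM_trunc n.+1) // mulrC. Qed.

Lemma fps1M : left_id fps1 fpsM.
Proof.
move=> a; apply: fpsP => n; rewrite /fpsM big_ord_recl /fps1 /= mul1r subn0.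
by rewrite big1 ?addr0 // => i _; rewrite mul0r.
Qed.

Lemma fpsMDl : left_distributive fpsM fpsD.
Proof.
move=> a b c; apply: fpsP => n; rewrite /fpsM /fpsD -big_split /=.
by apply: eq_bigr => i _; rewrite mulrDl.
Qed.

Lemma fps1_neq0 : fps1 != fps0.
Proof.
apply/eqP => /(congr1 (fun a : fps R => a 0%N)) /eqP.
by rewrite /fps1 /fps0 eqxx oner_eq0.
Qed.

HB.instance Definition _ :=
  GRing.Zmodule_isComNzRing.Build (fps R) fpsMA fpsMC fps1M fpsMDl fps1_neq0.

Lemma coef_fps0 n : (0 : fps R) n = 0. Proof. by []. Qed.
Lemma coef_fpsD a b n : (a + b) n = a n + b n. Proof. by []. Qed.
Lemma coef_fpsB a b n : (a - b) n = a n - b n. Proof. by []. Qed.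
Lemma coef_fpsM a b n : (a * b) n = \sum_(i < n.+1) a i * b (n - i)%N.
Proof. by []. Qed.

Lemma coef_fps_sum (I : Type) (r : seq I) (P : pred I) (F : I -> fps R) n :
  (\sum_(i <- r | P i) F i) n = \sum_(i <- r | P i) F i n.
Proof. by elim/big_rec2: _ => // i x y _ <-. Qed.

(** The constant term, as a ring morphism, decides the sign of square roots and witnesses that
    series are nonzero. *)
Definition fps_coef0 a : R := a 0%N.
Lemma fps_coef0_zmod : zmod_morphism fps_coef0. Proof. by []. Qed.
Lemma fps_coef0_monoid : monoid_morphism fps_coef0.
Proof. by split=> // a b; rewrite /fps_coef0 coef_fpsM big_ord1. Qed.
HB.instance Definition _ :=
  GRing.isZmodMorphism.Build (fps R) R fps_coef0 fps_coef0_zmod.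
HB.instance Definition _ :=
  GRing.isMonoidMorphism.Build (fps R) R fps_coef0 fps_coef0_monoid.

Definition fps_of_poly (p : {poly R}) : fps R := fun n => p`_n.
Lemma fps_of_poly_zmod : zmod_morphism fps_of_poly.
Proof. by move=> p q; apply: fpsP => n; rewrite /fps_of_poly coefB. Qed.
Lemma fps_of_poly_monoid : monoid_morphism fps_of_poly.
Proof.
split; first by apply: fpsP => n; rewrite /fps_of_poly coef1.
by move=> p q; apply: fpsP => n; rewrite /fps_of_poly coefM coef_fpsM.
Qed.
HB.instance Definition _ :=
  GRing.isZmodMorphism.Build {poly R} (fps R) fps_of_poly fps_of_poly_zmod.
HB.instance Definition _ :=
  GRing.isMonoidMorphism.Build {poly R} (fps R) fps_of_poly fps_of_poly_monoid.

Lemma coef_fps_const (c : R) a n : (fps_of_poly c%:P * a) n = c * a n.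
Proof.
rewrite coef_fpsM big_ord_recl big1 => [|i _].
  by rewrite /fps_of_poly coefC /= subn0 addr0.
by rewrite /fps_of_poly coefC /= mul0r.
Qed.

Definition fpsX : fps R := fps_of_poly 'X.

Lemma fpsXnE n : fpsX ^+ n = fps_of_poly 'X^n.
Proof. by rewrite rmorphXn. Qed.

Lemma coef_fps_Xn n i : (fpsX ^+ n) i = (i == n)%:R.
Proof. by rewrite fpsXnE /fps_of_poly coefXn. Qed.

Lemma coef_fps_XnM n a i : (fpsX ^+ n * a) i = if (i < n)%N then 0 else a (i - n)%N.
Proof.
rewrite coef_fpsM; case: ltnP => [lin|lni].
  rewrite big1 // => j _; have lj := ltn_ord j.
  by rewrite coef_fps_Xn (_ : (j : nat) == n = false) ?mul0r //; lia.
have lt : (n < i.+1)%N by [].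
rewrite (bigD1 (Ordinal lt)) //= coef_fps_Xn eqxx mul1r big1 ?addr0 // => j.
by rewrite -val_eqE /= coef_fps_Xn => /negbTE ->; rewrite mul0r.
Qed.

(** Congruence modulo [X^M], through which infinite sums and products are compared with their
    truncations. *)
Definition fps_eqm (M : nat) a b := forall n, (n < M)%N -> a n = b n.

Lemma fps_eqm_refl M a : fps_eqm M a a. Proof. by []. Qed.
Lemma fps_eqm_sym M a b : fps_eqm M a b -> fps_eqm M b a.
Proof. by move=> h n /h. Qed.
Lemma fps_eqm_trans M b a c : fps_eqm M a b -> fps_eqm M b c -> fps_eqm M a c.
Proof. by move=> h h' n lt; rewrite h // h'. Qed.
Lemma fps_eqmD M a b a' b' :
  fps_eqm M a b -> fps_eqm M a' b' -> fps_eqm M (a + a') (b + b').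
Proof. by move=> h h' n lt; rewrite !coef_fpsD h // h'. Qed.
Lemma fps_eqmM M a b a' b' :
  fps_eqm M a b -> fps_eqm M a' b' -> fps_eqm M (a * a') (b * b').
Proof.
move=> h h' n lt; rewrite !coef_fpsM; apply: eq_bigr => i _.
by rewrite h ?h' //; have := ltn_ord i; lia.
Qed.
Lemma fps_eqmX M a b k : fps_eqm M a b -> fps_eqm M (a ^+ k) (b ^+ k).
Proof.
move=> h; elim: k => [|k IH]; first by rewrite !expr0; exact: fps_eqm_refl.
by rewrite !exprS; exact: fps_eqmM.
Qed.
Lemma fps_eqm_sum M (I : Type) (r : seq I) (P : pred I) (F G : I -> fps R) :
  (forall i, P i -> fps_eqm M (F i) (G i)) ->
  fps_eqm M (\sum_(i <- r | P i) F i) (\sum_(i <- r | P i) G i).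
Proof. by move=> h n lt; rewrite !coef_fps_sum; apply: eq_bigr => i /h ->. Qed.
Lemma fps_eqm_XnM M k a : (M <= k)%N -> fps_eqm M (fpsX ^+ k * a) 0.
Proof. by move=> le n lt; rewrite coef_fps_XnM (leq_trans lt le). Qed.
Lemma fps_eqmW M a b : (forall M', (M <= M')%N -> fps_eqm M' a b) -> a = b.
Proof. by move=> h; apply: fpsP => n; apply: (h (maxn M n.+1)); lia. Qed.

End FpsRing.

Arguments fps_coef0 {R} a.
Arguments fpsX {R}.

(** * Power series over a domain form a domain *)

Section FpsDomain.
Variable R : idomainType.
Implicit Types a b c : fps R.

Lemma fps_neq0P a : a != 0 -> exists2 n, a n != 0 & forall i, (i < n)%N -> a i = 0.
Proof.
move=> /eqP a0; have [n an] : exists n, a n != 0.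
  by apply: contrapT => h; apply: a0; apply: fpsP => n; apply: contrapT => /eqP an;
     apply: h; exists n.
have ex : exists n, a n != 0 by exists n.
exists (ex_minn ex); case: ex_minnP => // m _ hm.
by move=> i; apply: contraTeq => ai; rewrite -leqNgt hm.
Qed.

(** The lowest nonzero coefficients, in degrees [i] and [j], multiply to the coefficient of degree
    [i + j]. *)
Lemma fps_mul_neq0 a b : a != 0 -> b != 0 -> a * b != 0.
Proof.
move=> /fps_neq0P[i ai hi] /fps_neq0P[j bj hj].
apply/eqP => /(congr1 (fun c : fps R => c (i + j)%N)) /eqP.
have lt : (i < (i + j).+1)%N by rewrite ltnS leq_addr.
rewrite coef_fpsM coef_fps0 (bigD1 (Ordinal lt)) //= big1 => [|k]; last first.
  rewrite -val_eqE /= => ki; have [lki|lik] := ltnP k i; first by rewrite hi ?mul0r.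
  by have lk := ltn_ord k; rewrite (hj (_ - _)%N) ?mulr0 //; move/eqP: ki; lia.
by rewrite addr0 addKn mulf_eq0 (negbTE ai) (negbTE bj).
Qed.

(** Inverses are chosen classically; they supply the unit ring structure beneath [idomainType], and
    thereby the fraction field in which eta quotients are computed. *)
Definition fps_unit : pred (fps R) := fun a => `[< exists b, b * a = 1 >].
Definition fps_inv a : fps R :=
  if pselect (exists b, b * a = 1) is left ex then projT1 (cid ex) else a.

Lemma fps_mulVr : {in fps_unit, left_inverse 1 fps_inv *%R}.
Proof.
move=> a /asboolP ex; rewrite /fps_inv; case: pselect => // ex'.
exact: (projT2 (cid ex')).
Qed.
Lemma fps_unitP a b : b * a = 1 -> fps_unit a.
Proof. by move=> h; apply/asboolP; exists b. Qed.
Lemma fps_inv_out : {in [predC fps_unit], fps_inv =1 id}.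
Proof. by move=> a /asboolP ex; rewrite /fps_inv; case: pselect. Qed.

HB.instance Definition _ :=
  GRing.ComNzRing_hasMulInverse.Build (fps R) fps_mulVr fps_unitP fps_inv_out.

Lemma fps_integral a b : a * b = 0 -> (a == 0) || (b == 0).
Proof.
move=> ab; apply/norP => -[a0 b0].
by have := fps_mul_neq0 a0 b0; rewrite ab eqxx.
Qed.

HB.instance Definition _ := GRing.ComUnitRing_isIntegral.Build (fps R) fps_integral.

Lemma fpsXn_neq0 n : fpsX ^+ n != 0 :> fps R.
Proof.
apply/eqP => /(congr1 (fun c : fps R => c n)) /eqP.
by rewrite coef_fps_Xn eqxx coef_fps0 oner_eq0.
Qed.

(** The coefficient of degree [n] in [c * a] is [c 0 * a n] plus terms in lower coefficients of [a],
    so strong induction cancels [c]. *)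
Lemma fps_eqmMI M a b c : fps_coef0 c != 0 ->
  fps_eqm M (c * a) (c * b) -> fps_eqm M a b.
Proof.
move=> c0 h n; elim/ltn_ind: n => n IH lt; have := h n lt.
rewrite !coef_fpsM !big_ord_recl /= !subn0.
rewrite [X in _ + X = _](_ : _ = \sum_(i < n) c (lift ord0 i) * b (n - lift ord0 i)%N).
  by move/addIr/(mulfI c0).
by apply: eq_bigr => i _; rewrite IH //= /bump /=; have := ltn_ord i; lia.
Qed.

End FpsDomain.

(** * Theta series *)

Section FamilySums.
Variable R : idomainType.

Definition proper_exp (I : choiceType) (e : I -> nat) :=
  forall n, finite_set [set i | (e i <= n)%N]%classic.

(* The formal sum of w i X^(e i) over i in I. An infinite support in a fibre of e
   contributes the junk value 0, so this is meaningful only for proper e. *)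
Definition fps_family (I : choiceType) (e : I -> nat) (w : I -> R) : fps R :=
  fun n => (\sum_(i \in [set i | e i = n]%classic) w i)%R.

Lemma proper_seq (I : choiceType) (e : I -> nat) n : proper_exp e ->
  exists2 s : seq I, uniq s & forall i, (i \in s) = (e i <= n)%N.
Proof.
move=> /(_ n) /finite_seqP[s hs]; exists (undup s); first exact: undup_uniq.
move=> i; rewrite mem_undup; apply/idP/idP => h.
  by have : [set` s]%classic i by []; rewrite -hs.
by have : [set i | (e i <= n)%N]%classic i by []; rewrite hs.
Qed.

Lemma coef_fps_family (I : choiceType) (e : I -> nat) w n (s : seq I) : uniq s ->
  (forall i, e i = n -> i \in s) ->
  fps_family e w n = \sum_(i <- s | e i == n) w i.
Proof.
move=> us hs; rewrite /fps_family -[RHS]big_filter.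
apply: fsbig_fwiden; rewrite ?filter_uniq //.
  by move=> i /= ein; rewrite mem_filter ein eqxx hs.
by move=> i [/=]; rewrite mem_filter => /andP[/eqP].
Qed.

Lemma proper_expM (I J : choiceType) (e : I -> nat) (e' : J -> nat) :
  proper_exp e -> proper_exp e' -> proper_exp (fun p : I * J => e p.1 + e' p.2)%N.
Proof.
move=> pe pe' n; apply: sub_finite_set (finite_setX (pe n) (pe' n)).
by move=> [i j] /=; lia.
Qed.

(** The indices that matter in degree [n] lie in finite lists [s] and [s'], so the Cauchy product
    becomes a finite sum over pairs. *)
Lemma fps_familyM (I J : choiceType) (e : I -> nat) (e' : J -> nat) w w' :
  proper_exp e -> proper_exp e' ->
  fps_family e w * fps_family e' w' =
  fps_family (fun p : I * J => e p.1 + e' p.2)%N (fun p => w p.1 * w' p.2).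
Proof.
move=> pe pe'; apply: fpsP => n.
have [s us hs] := proper_seq n pe; have [s' us' hs'] := proper_seq n pe'.
rewrite (@coef_fps_family _ _ _ n [seq (i, j) | i <- s, j <- s']); first last.
- by move=> [i j] /= ein; apply: allpairs_f; rewrite ?hs ?hs'; lia.
- by apply: allpairs_uniq => // -[i j] [i' j'].
rewrite big_mkcond big_allpairs coef_fpsM /=.
transitivity (\sum_(a < n.+1) \sum_(i <- s) \sum_(j <- s')
   if (e i == a) && (e' j == n - a)%N then w i * w' j else 0).
  apply: eq_bigr => a _; have la := ltn_ord a.
  rewrite (@coef_fps_family _ e w a s) //; last by move=> i ei; rewrite hs; lia.
  rewrite (@coef_fps_family _ e' w' (n - a) s') //; last by move=> i ei; rewrite hs'; lia.
  rewrite big_mkcond big_distrl /=; apply: eq_bigr => i _.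
  rewrite big_mkcond big_distrr /=; apply: eq_bigr => j _.
  by case: eqP => _; case: eqP => _; rewrite /= ?mul0r ?mulr0.
(* For fixed [i] and [j] only the summand [a = e i] survives. *)
rewrite exchange_big; apply: eq_big_seq => i; rewrite hs => ein.
rewrite exchange_big; apply: eq_bigr => j _.
have lt : (e i < n.+1)%N by [].
rewrite (bigD1 (Ordinal lt)) //= eqxx /= big1 => [|a]; last first.
  by rewrite -val_eqE /= eq_sym => /negbTE ->.
by rewrite addr0; congr (if _ then _ else _); apply/eqP/eqP; lia.
Qed.

Lemma fps_familyD (I : choiceType) (e : I -> nat) w w' : proper_exp e ->
  fps_family e (fun i => w i + w' i) = fps_family e w + fps_family e w'.
Proof.
move=> pe; apply: fpsP => n; have [s us hs] := proper_seq n pe.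
have cov i : e i = n -> i \in s by move=> ein; rewrite hs ein.
by rewrite coef_fpsD !(coef_fps_family _ us cov) big_split.
Qed.

Lemma fps_familyZ (I : choiceType) (e : I -> nat) w (c : R) : proper_exp e ->
  fps_family e (fun i => c * w i) = fps_of_poly c%:P * fps_family e w.
Proof.
move=> pe; apply: fpsP => n; have [s us hs] := proper_seq n pe.
have cov i : e i = n -> i \in s by move=> ein; rewrite hs ein.
by rewrite coef_fps_const !(coef_fps_family _ us cov) big_distrr.
Qed.

Lemma fps_family_Xn (I : choiceType) (e : I -> nat) w k : proper_exp e ->
  fpsX ^+ k * fps_family e w = fps_family (fun i => k + e i)%N w.
Proof.
move=> pe; apply: fpsP => n; have [s us hs] := proper_seq n pe.
rewrite coef_fps_XnM [RHS](coef_fps_family _ us) => [|i]; last by rewrite hs; lia.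
case: ltnP => [ltnk|lekn].
  by rewrite big1 // => i /eqP; lia.
rewrite (coef_fps_family _ us) => [|i]; last by rewrite hs; lia.
by apply: eq_bigl => i; apply/eqP/eqP; lia.
Qed.

(** The map [h] only has to reach the support of [w]: a weight that selects a parity class lets the
    sum be parametrised by that class. *)
Lemma fps_family_reindex (I J : choiceType) (h : J -> I) (e : I -> nat) w :
  injective h -> (forall i, w i != 0 -> exists j, i = h j) ->
  fps_family e w = fps_family (e \o h) (w \o h).
Proof.
move=> injh himg; apply: fpsP => n; rewrite /fps_family.
rewrite -(fsbig_image _ h w); last by move=> x y _ _ /injh.
apply/esym/fsbig_widen; first by move=> _ [j /= <- <-].
move=> i /= [ein nim]; apply/eqP; apply: contra_notT nim => /himg[j ij].
by exists j; rewrite /= ?ij // -ij.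
Qed.

Lemma eq_fps_family (I : choiceType) (e e' : I -> nat) (w w' : I -> R) :
  e =1 e' -> w =1 w' -> fps_family e w = fps_family e' w'.
Proof. by move=> /funext -> /funext ->. Qed.

End FamilySums.

(** * Theta series, their dissection by parity, and the cubic identity *)

Lemma proper_exp_int (e : int -> nat) : (forall x, (`|x| <= (e x).+1)%N) -> proper_exp e.
Proof.
move=> he n; pose s := [seq Posz i | i <- iota 0 n.+2] ++ [seq - Posz i | i <- iota 0 n.+2].
apply: (@sub_finite_set _ _ [set` s]%classic); last exact: finite_seq.
move=> x /= exn; have := he x; rewrite mem_cat => hx.
have [x0|x0] := leP 0 x; apply/orP; [left|right]; apply/mapP; exists `|x|%N;
  rewrite ?mem_iota; lia.
Qed.

(* Ramanujan's phi (s q^k), for s = 1 or s = -1. *)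
Definition phi (s : int) (k : nat) : fps int :=
  fps_family (fun x : int => k * `|x| ^ 2)%N (fun x => s ^+ `|x|%N).

(* Equals 2 psi (q^(2k)), as the exponents are invariant under m -> -1 - m. *)
Definition psi2 (k : nat) : fps int :=
  fps_family (fun m : int => k * `|(m * (m + 1))%R|)%N (fun=> 1).

Lemma proper_phi k : (0 < k)%N -> proper_exp (fun x : int => k * `|x| ^ 2)%N.
Proof. by move=> k0; apply: proper_exp_int => x; nia. Qed.

(** The slack 1 in [proper_exp_int] absorbs [m = -1], where the exponent vanishes. *)
Lemma proper_psi2 k : (0 < k)%N -> proper_exp (fun m : int => k * `|(m * (m + 1))%R|)%N.
Proof.
move=> k0; apply: proper_exp_int => x; rewrite abszM.
have [x1|x1] := posnP `|(x + 1)%R|%N; first lia.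
by rewrite ltnW // ltnS mulnCA leq_pmulr // muln_gt0 k0.
Qed.

Lemma expr_odd (R : comNzRingType) (s : R) n : s ^+ 2 = 1 -> s ^+ n = s ^+ odd n.
Proof.
by move=> s2; rewrite -{1}(odd_double_half n) exprD -mul2n exprM s2 expr1n mulr1.
Qed.

Lemma odd_abszE (x : int) : odd `|x|%N = ((x %% 2)%Z == 1).
Proof. by rewrite -[odd _]lt0b -modn2; lia. Qed.

(** Split by the parity of [x]: even [x = 2y] has sign 1 and exponent [4 k y^2]; odd [x = 2y + 1]
    has sign [s], and [x^2 = 1 + 4 y (y + 1)]. *)
Lemma phi_dissection (s : int) k : (0 < k)%N -> s ^+ 2 = 1 ->
  phi s k = phi 1 (4 * k) + fps_of_poly s%:P * fpsX ^+ k * psi2 (4 * k).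
Proof.
move=> k0 s2.
pose w0 (x : int) := if odd `|x| then 0 else s ^+ `|x|%N.
pose w1 (x : int) := if odd `|x| then s ^+ `|x|%N else 0.
have sE n := expr_odd n s2.
have -> : phi s k = fps_family (fun x : int => k * `|x| ^ 2)%N (fun x => w0 x + w1 x).
  by apply: eq_fps_family => // x; rewrite /w0 /w1; case: odd; rewrite ?add0r ?addr0.
rewrite fps_familyD; last exact: proper_phi.
congr (_ + _).
  rewrite (fps_family_reindex (h := fun y : int => 2 * y)).
  - apply: eq_fps_family => y /=; first by rewrite abszM expnMn mulnA (mulnC k).
    by rewrite /w0 expr1n sE odd_abszE (_ : (_ == _) = false) ?expr0 //; lia.
  - by move=> x y; lia.
  - move=> i; rewrite /w0 odd_abszE; case: ifP => //; rewrite ?eqxx // => oi _.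
    by exists (i %/ 2)%Z; lia.
rewrite -mulrA fps_family_Xn; last by apply: proper_psi2; lia.
rewrite -fps_familyZ; last first.
  have pe : proper_exp (fun m : int => 4 * k * `|(m * (m + 1))%R|)%N.
    by apply: proper_psi2; lia.
  by move=> n; apply: sub_finite_set (pe n) => x /=; lia.
rewrite (fps_family_reindex (h := fun y : int => 2 * y + 1)).
- apply: eq_fps_family => y /=.
    suff : (`|(2 * y + 1)%R| ^ 2 = 1 + 4 * `|(y * (y + 1))%R|)%N by nia.
    have y0 : 0 <= y * (y + 1) by nia.
    by nia.
  by rewrite /w1 mulr1 sE odd_abszE (_ : (_ == _) = true) ?expr1 //; lia.
- by move=> x y; lia.
- move=> i; rewrite /w1 odd_abszE; case: ifP => //; rewrite ?eqxx // => oi _.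
  by exists (i %/ 2)%Z; lia.
Qed.

(* The pairs (x, y) with x + y odd correspond, through 4 (x^2 + 3 y^2) =
   (x + 3y)^2 + 3 (x - y)^2, to the pairs of odd integers that agree modulo 4,
   which are half of all pairs of odd integers up to a change of sign. *)
Lemma phi_cubic k : (0 < k)%N ->
  phi 1 k * phi 1 (3 * k) - phi (-1) k * phi (-1) (3 * k)
  = fpsX ^+ k * psi2 k * psi2 (3 * k).
Proof.
move=> k0; have k30 : (0 < 3 * k)%N by lia.
pose T : choiceType := (int * int)%type.
pose e (p : T) := (k * `|p.1| ^ 2 + 3 * k * `|p.2| ^ 2)%N.
pose e2 (p : T) := (k + k * `|(p.1 * (p.1 + 1))%R| + 3 * k * `|(p.2 * (p.2 + 1))%R|)%N.
(* The common exponent to which [e] on odd [x + y], and [e2] on either parity class, are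
   reindexed. *)
pose e3 (p : T) :=
  `|(k%:Z * ((2 * p.2 + 1 + p.1) * (2 * p.2 + 1 + p.1) + 3 * (p.1 * p.1)))%R|%N.
have pe : proper_exp e by exact: (proper_expM (proper_phi k0) (proper_phi k30)).
have pe2' : proper_exp (fun m : int => k + k * `|(m * (m + 1))%R|)%N.
  by move=> n; apply: sub_finite_set (proper_psi2 k0 n) => x /=; lia.
have pe2 : proper_exp e2 by exact: (proper_expM pe2' (proper_psi2 k30)).
pose u (p : T) : int := if odd `|p.1 + p.2| then 1 else 0.
pose v (p : T) : int := if odd `|p.1 + p.2| then 0 else 1.
have sgnM (x y : int) : (-1) ^+ `|x|%N * (-1) ^+ `|y|%N = (-1) ^+ odd `|x + y| :> int.
  by rewrite -exprD -signr_odd; congr (_ ^+ nat_of_bool _);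
     rewrite odd_abszE -[LHS]lt0b -modn2; lia.
(* The sign [(-1)^(x + y)] cancels the pairs with [x + y] even and doubles the others. *)
have -> : phi 1 k * phi 1 (3 * k) - phi (-1) k * phi (-1) (3 * k)
        = fps_family e u + fps_family e u.
  rewrite !fps_familyM; [|exact: proper_phi..].
  apply/eqP; rewrite subr_eq -!fps_familyD //; apply/eqP/eq_fps_family => // p.
  by rewrite /= !expr1n sgnM /u; case: odd.
have -> : fpsX ^+ k * psi2 k * psi2 (3 * k) = fps_family e2 u + fps_family e2 v.
  rewrite fps_family_Xn; last exact: proper_psi2.
  rewrite fps_familyM //; last exact: proper_psi2.
  rewrite -!fps_familyD //; apply/eq_fps_family => // p.
  by rewrite /u /v; case: odd.
have absz_sq3 (x y : int) : `|(x * x + 3 * (y * y))%R|%N = (`|x| ^ 2 + 3 * `|y| ^ 2)%N.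
  have sqE (z : int) : z * z = (`|z| ^ 2)%N%:Z by rewrite -abszX gez0_abs ?sqr_ge0.
  by rewrite !sqE; lia.
have -> : fps_family e u = fps_family e3 (fun=> 1).
  rewrite (fps_family_reindex (h := fun p : T => (2 * p.2 + 1 + p.1, p.1) : T)).
  - apply: eq_fps_family => -[t n] /=.
      by rewrite /e /e3 /= abszM absz_nat absz_sq3 mulnDr mulnCA mulnA.
    by rewrite /u odd_abszE (_ : (_ == _) = true) //=; lia.
  - by move=> [x y] [x' y'] [/=]; move=> h1 h2; congr (_, _); lia.
  - move=> [x y]; rewrite /u odd_abszE; case: ifP; rewrite ?eqxx //= => h _.
    by exists (y, ((x - y) %/ 2)%Z) => /=; congr (_, _); lia.
have e2E (m n : int) : e2 (m, n) =
    `|(k%:Z * (1 + m * (m + 1) + 3 * (n * (n + 1))))%R|%N.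
  have m0 : 0 <= m * (m + 1) by nia.
  have n0 : 0 <= n * (n + 1) by nia.
  rewrite /e2 /= [RHS]abszM absz_nat.
  have -> : `|(1 + m * (m + 1) + 3 * (n * (n + 1)))%R|%N
      = (1 + `|(m * (m + 1))%R| + 3 * `|(n * (n + 1))%R|)%N by lia.
  by rewrite !mulnDr; lia.
congr (_ + _); apply/esym.
(* The reflection [n -> -1 - n] preserves [n (n + 1)] and flips parity, so both parity classes give
   the same series. *)
- rewrite (fps_family_reindex (h := fun p : T => (p.2 + 2 * p.1, -1 - p.2) : T)).
  + apply: eq_fps_family => -[t n] /=.
      by rewrite e2E /e3 /=; congr `|_|%N; ring.
    by rewrite /u odd_abszE (_ : (_ == _) = true) //=; lia.
  + by move=> [x y] [x' y'] [/=]; move=> h1 h2; congr (_, _); lia.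
  + move=> [x y]; rewrite /u odd_abszE; case: ifP; rewrite ?eqxx //= => h _.
    by exists (((x + y + 1) %/ 2)%Z, -1 - y) => /=; congr (_, _); lia.
- rewrite (fps_family_reindex (h := fun p : T => (p.2 + 2 * p.1, p.2) : T)).
  + apply: eq_fps_family => -[t n] /=.
      by rewrite e2E /e3 /=; congr `|_|%N; ring.
    by rewrite /v odd_abszE (_ : (_ == _) = false) //=; lia.
  + by move=> [x y] [x' y'] [/=]; move=> h1 h2; congr (_, _); lia.
  + move=> [x y]; rewrite /v odd_abszE; case: ifP; rewrite ?eqxx //= => h _.
    by exists (((x - y) %/ 2)%Z, y) => /=; congr (_, _); lia.
Qed.

(** * The triple product *)

Section QBinomial.
Variable R : comNzRingType.
Implicit Types q y z : R.

Definition qfact q n : R := \prod_(i < n) (1 - q ^+ i.+1).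

(** The Gaussian binomial by the [q]-Pascal rule, which avoids division and so makes sense in any
    commutative ring. *)
Fixpoint qbin q n j : R :=
  match n, j with
  | _, 0 => 1
  | 0, _.+1 => 0
  | n'.+1, j'.+1 => qbin q n' j' + q ^+ j * qbin q n' j
  end.

Lemma qfactS q n : qfact q n.+1 = qfact q n * (1 - q ^+ n.+1).
Proof. by rewrite /qfact big_ord_recr. Qed.

Lemma qbin_n0 q n : qbin q n 0 = 1. Proof. by case: n. Qed.

Lemma qbin_small q n j : (n < j)%N -> qbin q n j = 0.
Proof.
elim: n j => [|n IH] [|j] //= lt.
by rewrite !IH ?mulr0 ?addr0 // ltnW.
Qed.

Lemma qbin_fact q n j : (j <= n)%N -> qbin q n j * (qfact q j * qfact q (n - j)) = qfact q n.
Proof.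
elim: n j => [|n IH] [|j] // le; rewrite ?qbin_n0 ?subn0 /qfact ?big_ord0 ?mul1r //.
rewrite -!/(qfact _ _) /= subSS.
have [jn|nj] := leqP j.+1 n; last first.
  have -> : j = n by lia.
  rewrite (qbin_small _ (ltnSn n)) mulr0 addr0 !qfactS subnn.
  by have := IH n (leqnn n); rewrite subnn => h; rewrite -[X in _ = X * _]h; ring.
have h1 := IH j (ltnW jn); have h2 := IH j.+1 jn.
have nj : qfact q (n - j) = qfact q (n - j.+1) * (1 - q ^+ (n - j)).
  by rewrite (_ : n - j = (n - j.+1).+1)%N ?qfactS //; lia.
have nE : q ^+ n.+1 = q ^+ j.+1 * q ^+ (n - j) by rewrite -exprD; congr (_ ^+ _); lia.
rewrite (qfactS q n) nE mulrDl -[X in _ + X]mulrA nj.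
rewrite [X in _ + _ * X](_ : _ = qfact q n * (1 - q ^+ (n - j))); last by rewrite -h2; ring.
by rewrite (qfactS q j) -nj -h1; ring.
Qed.

(** Peeling off the factor [i = 0] leaves the same product with [z q] in place of [z]; the
    [q]-Pascal rule recombines the two sums. *)
Lemma qbinomial_theorem q y z n :
  \prod_(i < n) (y + z * q ^+ i)
  = \sum_(j < n.+1) qbin q n j * q ^+ 'C(j, 2) * z ^+ j * y ^+ (n - j).
Proof.
elim: n z => [|n IH] z.
  by rewrite big_ord0 big_ord1 /= bin0n !expr0 !mulr1.
rewrite big_ord_recl expr0 mulr1.
rewrite (eq_bigr (fun i : 'I_n => y + (z * q) * q ^+ i)); last first.
  by move=> i _; rewrite -mulrA -exprS.
rewrite IH mulrDl.
rewrite [RHS]big_ord_recl qbin_n0 subn0.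
have -> : \sum_(i < n.+1) qbin q n.+1 (lift ord0 i) * q ^+ 'C(lift ord0 i, 2)
      * z ^+ lift ord0 i * y ^+ (n.+1 - lift ord0 i)
  = z * (\sum_(j < n.+1) qbin q n j * q ^+ 'C(j, 2) * (z * q) ^+ j * y ^+ (n - j))
  + \sum_(j < n.+1) qbin q n j.+1 * q ^+ j.+1 * q ^+ 'C(j.+1, 2) * z ^+ j.+1
      * y ^+ (n - j).
  rewrite big_distrr -big_split; apply: eq_bigr => j _.
  rewrite [lift _ _ : nat]/= /bump /= add1n subSS binS bin1 exprMn !exprD !exprS.
  by ring.
rewrite [RHS]addrCA [LHS]addrC; congr (_ + _).
rewrite [X in _ * X]big_ord_recl [X in _ = _ + X]big_ord_recr /= (qbin_small _ (ltnSn n)).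
rewrite !mul0r addr0 qbin_n0 subn0 mulrDr; congr (_ + _).
  by rewrite !expr0 (exprS y); ring.
rewrite big_distrr; apply: eq_bigr => j _ /=.
rewrite /bump /= add1n (_ : n - j = (n - j.+1).+1)%N; last by have := ltn_ord j; lia.
by rewrite exprMn !exprS; ring.
Qed.

End QBinomial.

(** * The finite triple product and its limit *)

Lemma prod_even_pow (R : comNzRingType) (q : R) n :
  \prod_(i < n) q ^+ i.*2 = q ^+ (n * n.-1).
Proof.
elim: n => [|n IH]; first by rewrite big_ord0.
by rewrite big_ord_recr /= IH -exprD; congr (_ ^+ _); nia.
Qed.

(** The [q]-binomial theorem in base [q^2] with [2N] factors and [y = q^(2N-1)]: after powers of [q]
    are pulled out, the first [N] factors become [z + q^(2i+1)] in reverse order and the others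
    [1 + z q^(2i+1)]. The factor [z^N] relative to the usual symmetric form avoids negative powers
    of [z]. *)
Lemma jacobi_triple_finite (R : idomainType) (q z : R) N : q != 0 ->
  \prod_(i < N) ((z + q ^+ i.*2.+1) * (1 + z * q ^+ i.*2.+1))
  = \sum_(j < N.*2.+1) qbin (q ^+ 2) N.*2 j * q ^+ (`|j%:Z - N%:Z| ^ 2) * z ^+ j.
Proof.
(* [S] is the exponent pulled out: the sum of [2i] over [i < N], plus [N] times [2N - 1]. *)
move=> q0; pose S := (N * N.-1 + N * N.*2.-1)%N.
have qS0 : q ^+ S != 0 by rewrite expf_neq0.
apply: (mulfI qS0).
transitivity (\prod_(i < N.*2) (q ^+ N.*2.-1 + z * (q ^+ 2) ^+ i)).
  rewrite -[in RHS](addnn N) big_split_ord /= big_split exprD mulrACA /=; congr (_ * _).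
    rewrite -prod_even_pow [X in _ * X](reindex_inj rev_ord_inj) -big_split /=.
    apply: eq_bigr => i _; have lti := ltn_ord i.
    rewrite -exprM mul2n mulrDr -exprD addrC [z * _]mulrC.
        by congr (q ^+ _ + _); lia.
    rewrite mulnC exprM.
  have -> : (q ^+ N.*2.-1) ^+ N = \prod_(i < N) q ^+ N.*2.-1.
    by rewrite prodr_const card_ord.
  rewrite -big_split /=; apply: eq_bigr => i _; have lti := ltn_ord i.
  rewrite addnn mulrDr mulr1 mulrCA -exprM -exprD.
  by congr (_ + z * q ^+ _); lia.
rewrite qbinomial_theorem big_distrr; apply: eq_bigr => j _ /=.
have ltj := ltn_ord j.
rewrite -!exprM; have bj : ('C(j, 2) * 2 = j * j.-1)%N.
  by rewrite bin2 muln2 even_halfK //; case: (nat_of_ord j) => // n; rewrite oddM /= andNb.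
suff : q ^+ (2 * 'C(j, 2)) * q ^+ (N.*2.-1 * (N.*2 - j))
     = q ^+ S * q ^+ (`|j%:Z - N%:Z| ^ 2).
  move=> h; transitivity (qbin (q ^+ 2) N.*2 j * z ^+ j
    * (q ^+ (2 * 'C(j, 2)) * q ^+ (N.*2.-1 * (N.*2 - j)))); first by ring.
  by rewrite h; ring.
rewrite -!exprD; congr (_ ^+ _); rewrite /S mulnC bj.
move: (nat_of_ord j) ltj => {bj}j ltj.
(* To check the quadratic identity in [nat], predecessors are eliminated, and each case below writes
   [N] and [j] as sums so that no truncated subtraction remains. *)
have predM n : (n * n.-1 + n = n * n)%N by case: n => // n; rewrite mulnS addnC.
have predM2 n a : (0 < n)%N -> (n.-1 * a + a = n * a)%N by case: n => // n _; rewrite mulSn addnC.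
have [N0|N0] := posnP N; first by move: ltj; rewrite N0; case: (j).
have eq1 := predM N; have eq2 := predM j.
have eq3 := predM2 N.*2 (N.*2 - j)%N; have eq4 := predM2 N.*2 N.
have [le|lt] := leqP j N.
  have [d Nd] : exists d, (N = j + d)%N by exists (N - j)%N; lia.
  have e1 : `|j%:Z - N%:Z|%N = d by lia.
  have e2 : (N.*2 - j = j + 2 * d)%N by lia.
  move: eq1 eq2 eq3 eq4; rewrite e1 e2 [(N * N.*2.-1)%N]mulnC -mul2n Nd.
  by rewrite !(mulnDl, mulnDr); lia.
have [d jd] : exists d, (j = N + d)%N by exists (j - N)%N; lia.
have [m Nm] : exists m, (N = d + m)%N by exists (N - d)%N; lia.
have e1 : `|j%:Z - N%:Z|%N = d by lia.
have e2 : (N.*2 - j = m)%N by lia.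
move: eq1 eq2 eq3 eq4; rewrite e1 e2 [(N * N.*2.-1)%N]mulnC jd -mul2n Nm.
by rewrite !(mulnDl, mulnDr); lia.
Qed.

(** The product [f_k] as a formal series: for [k > 0] the factors beyond the first [n] do not affect
    the coefficient of degree [n]. *)
Definition eta (k : nat) : fps int := fun n => qfact (fpsX ^+ k) n n.

Lemma eta_eqm k M N : (0 < k)%N -> (M <= N.+1)%N ->
  fps_eqm M (eta k) (qfact (fpsX ^+ k) N).
Proof.
move=> k0 leM n ltn; rewrite /eta.
have : (n <= N)%N by lia.
elim: N {leM} => [|N IH] leN; first by have -> : n = 0%N by lia.
have [->//|neq] := eqVneq n N.+1.
rewrite IH; last by move/eqP: neq; lia.
rewrite qfactS mulrBr mulr1 coef_fpsB mulrC -exprM coef_fps_XnM.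
by rewrite (_ : (n < k * N.+1)%N) ?subr0 //; move/eqP: neq; nia.
Qed.

Lemma eta_coef0 k : fps_coef0 (eta k) = 1.
Proof. by rewrite /fps_coef0 /eta /qfact big_ord0. Qed.

(** All three [q]-factorials in the binomial have at least [M] factors, so each agrees with [eta k]
    modulo [X^M]. *)
Lemma eta_qbin_eqm k M N j : (0 < k)%N -> (M <= j)%N -> (M + j <= N)%N ->
  fps_eqm M (eta k * qbin (fpsX ^+ k) N j) 1.
Proof.
move=> k0 lej leN; apply: (@fps_eqmMI _ _ _ _ (eta k)); first by rewrite eta_coef0 oner_eq0.
rewrite mulr1; apply: fps_eqm_trans (fps_eqm_sym (eta_eqm (N := N) k0 _)); last by lia.
rewrite -(@qbin_fact _ _ N j); last by lia.
have -> : eta k * (eta k * qbin (fpsX ^+ k) N j) = qbin (fpsX ^+ k) N j * (eta k * eta k).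
  by ring.
by apply: fps_eqmM => //; apply: fps_eqmM; apply: eta_eqm; lia.
Qed.

(* The q-binomial coefficients of the finite triple product tend to 1/eta k in
   the central range and are irrelevant outside of it. *)
Lemma eta_qbin_sum_eqm k M (t : nat -> fps int) : (0 < k)%N ->
  (forall j, (M < `|j%:Z - M.*2%:Z|)%N -> fps_eqm M (t j) 0) ->
  fps_eqm M (eta k * \sum_(j < M.*2.*2.+1) qbin (fpsX ^+ k) M.*2.*2 j * t j)
            (\sum_(j < M.*2.*2.+1) t j).
Proof.
move=> k0 ht; rewrite big_distrr; apply: fps_eqm_sum => j _ /=; rewrite mulrA.
have [/ht h|h] := ltnP M `|j%:Z - M.*2%:Z|.
  apply: fps_eqm_trans (fps_eqm_sym h).
  rewrite -[X in fps_eqm _ _ X](mulr0 (eta k * qbin (fpsX ^+ k) M.*2.*2 j)).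
  exact: fps_eqmM.
(* Distance at most [M] from the centre [2M] gives [j >= M] and [4M - j >= M]. *)
rewrite -[X in fps_eqm _ _ X]mul1r; apply: fps_eqmM => //.
by apply: eta_qbin_eqm => //; lia.
Qed.

Lemma coef_fps_family_centered (e : int -> nat) (w : int -> int) N n :
  (forall x, e x = n -> (`|x| <= N)%N) ->
  fps_family e w n =
  \sum_(j < N.*2.+1) w (j%:Z - N%:Z) * (e (j%:Z - N%:Z) == n)%:R.
Proof.
move=> he; rewrite (@coef_fps_family _ _ _ _ _ [seq j%:Z - N%:Z | j <- iota 0 N.*2.+1]).
- rewrite big_map big_mkcond -[RHS](big_mkord xpredT
    (fun j : nat => w (j%:Z - N%:Z) * (e (j%:Z - N%:Z) == n)%:R)) /index_iota subn0.
  by apply: eq_bigr => j _; case: eqP; rewrite ?mulr1 ?mulr0.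
- by rewrite map_inj_uniq ?iota_uniq // => i j; lia.
- move=> x /he; rewrite -[x]/(x : int) => hx.
  by apply/mapP; exists `|(x + N%:Z)%R|%N; rewrite ?mem_iota; lia.
Qed.

(** The sign [s ^+ j] may stand for [s] to the power [|j - 2M|] because the centre [2M] is even. *)
Lemma phi_eqm k s M : (0 < k)%N -> s ^+ 2 = 1 ->
  fps_eqm M (\sum_(j < M.*2.*2.+1)
     (fpsX ^+ k) ^+ (`|j%:Z - M.*2%:Z| ^ 2) * fps_of_poly s%:P ^+ j) (phi s k).
Proof.
move=> k0 s2 n ltn; rewrite coef_fps_sum /phi (@coef_fps_family_centered _ _ M.*2).
  apply: eq_bigr => j _; rewrite mulrC -rmorphXn -polyC_exp coef_fps_const -exprM coef_fps_Xn.
  rewrite [n == _]eq_sym; congr (_ * _).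
  rewrite (expr_odd _ s2) [RHS](expr_odd _ s2); congr (_ ^+ nat_of_bool _).
  by rewrite odd_abszE -[LHS]lt0b -modn2; lia.
by move=> x; nia.
Qed.

Lemma psi2_eqm k M : (0 < k)%N ->
  fps_eqm M (\sum_(j < M.*2.*2.+1)
     (fpsX ^+ k) ^+ `|((j%:Z - M.*2%:Z) * (j%:Z - M.*2%:Z + 1))%R|) (psi2 k).
Proof.
move=> k0 n ltn; rewrite coef_fps_sum /psi2 (@coef_fps_family_centered _ _ M.*2).
  by apply: eq_bigr => j _; rewrite mul1r -exprM coef_fps_Xn eq_sym.
move=> x; rewrite abszM => h.
have [x1|x1] := posnP `|(x + 1)%R|%N; first lia.
by have := leq_pmulr `|x| x1; nia.
Qed.

(** * Product formulas for the theta series *)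

Section FiniteProducts.
Variable R : comNzRingType.
Implicit Type q : R.

Lemma qfact_odd q n :
  \prod_(i < n) (1 - q ^+ i.*2.+1) * qfact (q ^+ 2) n = qfact q n.*2.
Proof.
elim: n => [|n IH]; first by rewrite /qfact !big_ord0 mul1r.
by rewrite doubleS big_ord_recr !qfactS -IH -!exprM mul2n doubleS /=; ring.
Qed.

Lemma qfact_plus q n : \prod_(i < n) (1 + q ^+ i.+1) * qfact q n = qfact (q ^+ 2) n.
Proof.
rewrite /qfact -big_split; apply: eq_bigr => i _ /=.
by rewrite -exprM mulnC exprM; ring.
Qed.

Lemma prod_odd_plus q n :
  \prod_(i < n) (1 + q ^+ i.*2.+1) * \prod_(i < n) (1 - q ^+ i.*2.+1)
  = \prod_(i < n) (1 - (q ^+ 2) ^+ i.*2.+1).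
Proof.
rewrite -big_split; apply: eq_bigr => i _ /=.
by rewrite -exprM mulnC exprM; ring.
Qed.

End FiniteProducts.

Lemma fpsX_mul2 k : fpsX ^+ (2 * k) = (fpsX ^+ k) ^+ 2 :> fps int.
Proof. by rewrite -exprM mulnC. Qed.

Lemma phi_prod_eqm k (s : int) M : (0 < k)%N -> s ^+ 2 = 1 ->
  fps_eqm M (phi s k)
    (eta (2 * k) * (\prod_(i < M.*2)
       (1 + fps_of_poly s%:P * (fpsX ^+ k : fps int) ^+ i.*2.+1)) ^+ 2).
Proof.
move=> k0 s2; set z := fps_of_poly _; set q := fpsX ^+ k.
have z2 : z ^+ 2 = 1 by rewrite /z -rmorphXn -polyC_exp s2 rmorph1.
have jt := jacobi_triple_finite z M.*2 (fpsXn_neq0 _ k).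
apply: fps_eqm_trans (fps_eqm_sym (@phi_eqm k s M k0 s2)) _.
rewrite -/z -/q.
have -> : (\prod_(i < M.*2) (1 + z * q ^+ i.*2.+1)) ^+ 2
    = \prod_(i < M.*2) ((z + q ^+ i.*2.+1) * (1 + z * q ^+ i.*2.+1)).
  (* Since [z^2 = 1], each [z + q^(2i+1)] is [z (1 + z q^(2i+1))], and the [2M] extra factors [z]
     multiply to 1. *)
  have z1 : \prod_(i < M.*2) z = 1 by rewrite prodr_const card_ord -mul2n exprM z2 expr1n.
  rewrite expr2 -[LHS]mul1r -{1}z1 -!big_split; apply: eq_bigr => i _ /=.
  by rewrite -[in RHS](mul1r (q ^+ _)) -[in X in _ = X * _]z2; ring.
rewrite jt.
under [X in eta _ * X]eq_bigr do rewrite -mulrA.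
apply: fps_eqm_sym; rewrite -[q ^+ 2]fpsX_mul2.
apply: (@eta_qbin_sum_eqm (2 * k) M (fun j => q ^+ (`|j%:Z - M.*2%:Z| ^ 2) * z ^+ j)).
  by lia.
by move=> j ltj; rewrite -exprM; apply: fps_eqm_XnM; nia.
Qed.

Lemma phiN1_prod k : (0 < k)%N -> phi (-1) k * eta (2 * k) = eta k ^+ 2.
Proof.
move=> k0; apply: (@fps_eqmW _ 0) => M _.
apply: (fps_eqm_trans (fps_eqmM (@phi_prod_eqm k (-1) M k0 (sqrrN 1))
  (@fps_eqm_refl _ M (eta (2 * k))))).
set z := fps_of_poly _; have -> : z = -1 by rewrite /z polyCN rmorphN rmorph1.
rewrite (eq_bigr (fun i : 'I_M.*2 => 1 - (fpsX ^+ k) ^+ i.*2.+1)) => [|i _]; last first.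
  by rewrite mulN1r.
set O := \prod_(i < _) _.
have -> : eta (2 * k) * O ^+ 2 * eta (2 * k) = (O * eta (2 * k)) ^+ 2 by ring.
apply: fps_eqmX; have e1 : fps_eqm M (eta (2 * k)) (qfact (fpsX ^+ (2 * k)) M.*2).
  by apply: eta_eqm; lia.
apply: (fps_eqm_trans (fps_eqmM (@fps_eqm_refl _ M O) e1)).
by rewrite fpsX_mul2 qfact_odd; apply/fps_eqm_sym/eta_eqm; lia.
Qed.

(** With [P] and [O] the products of [1 + q^(2i+1)] and [1 - q^(2i+1)], in the limit
    [O = f_k / f_2k] and [P O = f_2k / f_4k], while [phi] is [f_2k P^2]. *)
Lemma phi1_prod k : (0 < k)%N ->
  phi 1 k * (eta k ^+ 2 * eta (4 * k) ^+ 2) = eta (2 * k) ^+ 5.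
Proof.
move=> k0; apply: (@fps_eqmW _ 0) => M _.
apply: (fps_eqm_trans (fps_eqmM (@phi_prod_eqm k 1 M k0 (expr1n _ 2))
  (@fps_eqm_refl _ M _))).
set z := fps_of_poly _; have -> : z = 1 by rewrite /z rmorph1.
rewrite (eq_bigr (fun i : 'I_M.*2 => 1 + (fpsX ^+ k) ^+ i.*2.+1)) => [|i _]; last first.
  by rewrite mul1r.
set P := \prod_(i < _) _; set q := fpsX ^+ k in P *.
pose O := \prod_(i < M.*2) (1 - q ^+ i.*2.+1).
have e1 : fps_eqm M (O * eta (2 * k)) (eta k).
  apply: (@fps_eqm_trans _ _ (O * qfact (q ^+ 2) M.*2)).
    by apply: fps_eqmM => //; rewrite -fpsX_mul2; apply: eta_eqm; lia.
  by rewrite qfact_odd; apply/fps_eqm_sym/eta_eqm; lia.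
have e2 : fps_eqm M (P * O * eta (4 * k)) (eta (2 * k)).
  rewrite prod_odd_plus.
  apply: (@fps_eqm_trans _ _ (\prod_(i < M.*2) (1 - (q ^+ 2) ^+ i.*2.+1)
                              * qfact ((q ^+ 2) ^+ 2) M.*2)).
    apply: fps_eqmM => //; rewrite -!fpsX_mul2 mulnA.
    by apply: eta_eqm; lia.
  by rewrite qfact_odd -fpsX_mul2; apply/fps_eqm_sym/eta_eqm; lia.
have e3 : fps_eqm M (P * eta k * eta (4 * k)) (eta (2 * k) ^+ 2).
  apply: (@fps_eqm_trans _ _ (P * (O * eta (2 * k)) * eta (4 * k))).
    by do 2 apply: fps_eqmM => //; exact: fps_eqm_sym.
  have -> : P * (O * eta (2 * k)) * eta (4 * k) = P * O * eta (4 * k) * eta (2 * k) by ring.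
  by rewrite expr2; apply: fps_eqmM.
have -> : eta (2 * k) * P ^+ 2 * (eta k ^+ 2 * eta (4 * k) ^+ 2)
  = eta (2 * k) * (P * eta k * eta (4 * k)) ^+ 2 by ring.
rewrite (exprS _ 4) (exprM _ 2 2); apply: fps_eqmM => //.
exact: fps_eqmX.
Qed.

(** The triple product at [z = q], where [q + q^(2i+1) = q (1 + q^(2i))]; the factor at [i = 0]
    supplies the 2. *)
Lemma psi2_prod k : (0 < k)%N -> psi2 k * eta (2 * k) = 2 * eta (4 * k) ^+ 2.
Proof.
move=> k0; apply: (@fps_eqmW _ 0) => M _.
set q := fpsX ^+ k : fps int.
have jt := jacobi_triple_finite q M.*2 (fpsXn_neq0 _ k : q != 0).
pose E := \prod_(i < M.*2) (1 + (q ^+ 2) ^+ i.+1).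
pose E' := \prod_(i < M.*2) (1 + (q ^+ 2) ^+ i).
have jt' : E' * E = \sum_(j < M.*2.*2.+1) qbin (q ^+ 2) M.*2.*2 j
    * q ^+ `|((j%:Z - M.*2%:Z) * (j%:Z - M.*2%:Z + 1))%R|.
  have qN0 : q ^+ M.*2 != 0 by rewrite expf_neq0 // fpsXn_neq0.
  apply: (mulfI qN0); transitivity (\prod_(i < M.*2)
      ((q + q ^+ i.*2.+1) * (1 + q * q ^+ i.*2.+1))).
    have -> : q ^+ M.*2 = \prod_(i < M.*2) q by rewrite prodr_const card_ord.
    rewrite -!big_split; apply: eq_bigr => i _ /=.
    have -> : q ^+ i.*2.+1 = q * (q ^+ 2) ^+ i by rewrite exprS -exprM mul2n.
    by rewrite (exprS (q ^+ 2) i); ring.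
  rewrite jt big_distrr; apply: eq_bigr => j _ /=.
  rewrite -mulrA -exprD [RHS]mulrCA -exprD; congr (_ * q ^+ _).
  (* The [q^N] to be cancelled comes from [t^2 + j = t (t + 1) + N]. *)
  set N := M.*2; set t := j%:Z - N%:Z.
  have t0 : 0 <= t * (t + 1) by nia.
  have : (`|(t * (t + 1))%R|%N%:Z = (`|t| ^ 2)%N%:Z + t).
    by rewrite gez0_abs // -abszX gez0_abs ?sqr_ge0 //; ring.
  by move=> h; apply/eqP; rewrite -eqz_nat !PoszD h /t; apply/eqP; ring.
have e1 : fps_eqm M (eta (2 * k) * (E' * E)) (psi2 k).
  apply: fps_eqm_trans (@psi2_eqm k M k0); rewrite jt' -fpsX_mul2.
  apply: (@eta_qbin_sum_eqm (2 * k) M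
    (fun j => q ^+ `|((j%:Z - M.*2%:Z) * (j%:Z - M.*2%:Z + 1))%R|)); first by lia.
  move=> j ltj; rewrite -exprM -[fpsX ^+ _]mulr1; apply: fps_eqm_XnM.
  rewrite abszM; apply: (@leq_trans `|(j%:Z - M.*2%:Z + 1)%R|); first by lia.
  by rewrite mulnA leq_pmull // muln_gt0 k0 (leq_trans _ ltj).
(* [2 * E] has one more factor than [E'], and that factor is 1 modulo [X^M]. *)
have e2 : fps_eqm M E' (2 * E).
  have -> : 2 * E = \prod_(i < M.*2.+1) (1 + (q ^+ 2) ^+ i).
    by rewrite big_ord_recl expr0.
  rewrite big_ord_recr /= -/E' mulrDr mulr1 -[X in fps_eqm _ X]addr0.
  apply: fps_eqmD => //; apply: fps_eqm_sym.
  by rewrite -!exprM mulrC; apply: fps_eqm_XnM; nia.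
have e3 : fps_eqm M (E * eta (2 * k)) (eta (4 * k)).
  apply: (@fps_eqm_trans _ _ (E * qfact (q ^+ 2) M.*2)).
    by apply: fps_eqmM => //; rewrite -fpsX_mul2; apply: eta_eqm; lia.
  rewrite qfact_plus -!fpsX_mul2 mulnA; apply/fps_eqm_sym/eta_eqm; lia.
apply: (@fps_eqm_trans _ _ (eta (2 * k) * (2 * E * E) * eta (2 * k))).
  apply: fps_eqmM => //; apply: fps_eqm_trans (fps_eqm_sym e1) _.
  by do 2 apply: fps_eqmM => //.
have -> : eta (2 * k) * (2 * E * E) * eta (2 * k) = 2 * (E * eta (2 * k)) ^+ 2 by ring.
by apply: fps_eqmM => //; exact: fps_eqmX.
Qed.

(** * The modular equation of degree 3 and its consequences *)

(* Here et, ph, phN, ps and c stand for eta, phi 1, phi (-1), psi2 and fps_coef0.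
   The ring is kept abstract because unification in fps int would compare
   coefficients. *)
Section ThetaAlgebra.
Variables (R : idomainType) (c : {rmorphism R -> int}) (X : R).
Variables et ph phN ps : nat -> R.
Hypothesis X0 : X != 0.
Hypothesis et1 : forall k, c (et k) = 1.
Hypothesis phiN1_prod : forall k, (0 < k)%N -> phN k * et (2 * k) = et k ^+ 2.
Hypothesis phi1_prod : forall k, (0 < k)%N ->
  ph k * (et k ^+ 2 * et (4 * k) ^+ 2) = et (2 * k) ^+ 5.
Hypothesis psi2_prod : forall k, (0 < k)%N -> ps k * et (2 * k) = 2 * et (4 * k) ^+ 2.
Hypothesis phi1_dissection : forall k, (0 < k)%N ->
  ph k = ph (4 * k) + X ^+ k * ps (4 * k).
Hypothesis phiN1_dissection : forall k, (0 < k)%N ->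
  phN k = ph (4 * k) - X ^+ k * ps (4 * k).
Hypothesis phi_cubic : forall k, (0 < k)%N ->
  ph k * ph (3 * k) - phN k * phN (3 * k) = X ^+ k * ps k * ps (3 * k).

Local Notation "x %:F" := (@tofrac R x).

Lemma c_neq0 (a : R) : c a != 0 -> a != 0.
Proof. by apply: contraNneq => ->; rewrite rmorph0. Qed.

(** In a domain [a = b] or [a = -b], and the constant terms exclude the latter. Every extraction of
    a square root below goes through this. *)
Lemma sqrf_c_inj (a b : R) : a ^+ 2 = b ^+ 2 -> c a + c b != 0 -> a = b.
Proof.
move=> /eqP; rewrite -rmorphD eqf_sqr => /orP[/eqP//|/eqP ->].
by rewrite addNr rmorph0 eqxx.
Qed.

Lemma et_neq0 k : et k != 0.
Proof. by apply: c_neq0; rewrite et1. Qed.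

Definition coef0E := (rmorphB c, rmorphD c, rmorphXn c, rmorphM c, rmorph_nat c,
  et1, expr1n, mulr1).
Lemma tofrac2 : (2 : R)%:F = 2. Proof. exact: rmorph_nat. Qed.
Definition tofracE := (tofrac2, @tofracXn R, @tofracM R).

Lemma X_mul2 k : X ^+ (2 * k) = (X ^+ k) ^+ 2.
Proof. by rewrite -exprM mulnC. Qed.

Lemma tofrac_inj (a b : R) : a%:F = b%:F -> a = b.
Proof. by move/eqP; rewrite tofrac_eq => /eqP. Qed.

Lemma tofrac_et_neq0 k : (et k)%:F != 0.
Proof. by rewrite tofrac_eq0 et_neq0. Qed.

(** Indices come with equations so that they can be given in the form of the goal, such as [6 * k]
    for [2 * (3 * k)]. *)
Lemma tofrac_phiN1 k k2 : (0 < k)%N -> k2 = (2 * k)%N ->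
  (phN k)%:F = (et k)%:F ^+ 2 / (et k2)%:F.
Proof.
move=> k0 ->; rewrite -rmorphXn -(phiN1_prod k0) rmorphM.
by rewrite mulfK // tofrac_et_neq0.
Qed.

Lemma tofrac_phi1 k k2 k4 : (0 < k)%N -> k2 = (2 * k)%N -> k4 = (4 * k)%N ->
  (ph k)%:F = (et k2)%:F ^+ 5 / ((et k)%:F ^+ 2 * (et k4)%:F ^+ 2).
Proof.
move=> k0 -> ->; apply: (canRL (mulfK _)).
  by rewrite mulf_neq0 ?expf_neq0 ?tofrac_et_neq0.
by rewrite -!rmorphXn -!rmorphM phi1_prod.
Qed.

Lemma tofrac_ps k k2 k4 : (0 < k)%N -> k2 = (2 * k)%N -> k4 = (4 * k)%N ->
  (ps k)%:F = 2 * (et k4)%:F ^+ 2 / (et k2)%:F.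
Proof.
move=> k0 -> ->; apply: (canRL (mulfK _)); first by rewrite tofrac_et_neq0.
by rewrite -rmorphM psi2_prod // rmorphM rmorphXn rmorph_nat.
Qed.

(** * Quadratic and quartic relations between theta series *)

Definition phiA k := ph k * ph (3 * k).
Definition phiB k := phN k * phN (3 * k).

Section ThetaRelations.
Variable k : nat.
Hypothesis k0 : (0 < k)%N.

Lemma phi1_phiN1 : ph k * phN k = phN (2 * k) ^+ 2.
Proof.
have key (F : fieldType) (x y z : F) : x != 0 -> y != 0 -> z != 0 ->
    y ^+ 5 / (x ^+ 2 * z ^+ 2) * (x ^+ 2 / y) = (y ^+ 2 / z) ^+ 2.
  by move=> x0 y0 z0; field; rewrite x0 y0 z0.
apply: tofrac_inj; rewrite tofracM tofracXn.
rewrite (tofrac_phi1 k0 (erefl _) (erefl _)) (tofrac_phiN1 k0 (erefl _)).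
rewrite (@tofrac_phiN1 _ (4 * k)); [|lia..].
by apply: key; rewrite tofrac_et_neq0.
Qed.

Lemma phi1_ps : 2 * (ph (2 * k) * ps (2 * k)) = ps k ^+ 2.
Proof.
have key (F : fieldType) (x y z : F) : x != 0 -> y != 0 -> z != 0 ->
    2 * (y ^+ 5 / (x ^+ 2 * z ^+ 2) * (2 * z ^+ 2 / y)) = (2 * y ^+ 2 / x) ^+ 2.
  by move=> x0 y0 z0; field; rewrite x0 y0 z0.
apply: tofrac_inj; rewrite tofracM tofracM tofracXn rmorph_nat.
rewrite (@tofrac_phi1 _ (4 * k) (8 * k)); [|lia..].
rewrite (@tofrac_ps (2 * k) (4 * k) (8 * k)); [|lia..].
rewrite (@tofrac_ps k (2 * k) (4 * k)); [|lia..].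
by apply: key; rewrite tofrac_et_neq0.
Qed.

Lemma phiA_sub_phiB : phiA k - phiB k = X ^+ k * ps k * ps (3 * k).
Proof. exact: phi_cubic. Qed.

End ThetaRelations.

Section ThetaRelations2.
Variable k : nat.
Hypothesis k0 : (0 < k)%N.

Lemma phi_sqrB : ph (2 * k) ^+ 2 - phN (2 * k) ^+ 2
  = 2 * (X ^+ (2 * k) * ps (4 * k) ^+ 2).
Proof.
have k20 : (0 < 2 * k)%N by lia.
have := @phi1_ps (4 * k); rewrite !mulnA => <-; last by lia.
rewrite (phi1_dissection k20) (phiN1_dissection k20) !mulnA.
by ring.
Qed.

(** Dissecting both factors of [phi1_phiN1] gives [phN (2 * k) ^+ 2] as a difference of squares;
    [phi_sqrB] then gives the other square. *)
Lemma phi_sqrD : ph (2 * k) ^+ 2 + phN (2 * k) ^+ 2 = 2 * ph (4 * k) ^+ 2.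
Proof.
have h := phi1_phiN1 k0.
move: h; rewrite (phi1_dissection k0) (phiN1_dissection k0) => h.
have := phi_sqrB; rewrite X_mul2 => /eqP; rewrite subr_eq => /eqP ->.
by rewrite -h; ring.
Qed.

(** Jacobi's [phi(q)^4 - phi(-q)^4 = 16 q psi(q^2)^4], the product of the two preceding
    relations. *)
Lemma phi_quarticB : ph (2 * k) ^+ 4 - phN (2 * k) ^+ 4
  = X ^+ (2 * k) * ps (2 * k) ^+ 4.
Proof.
have k20 : (0 < 2 * k)%N by lia.
have := phi1_ps k20; rewrite !mulnA => h.
rewrite (exprM _ 2 2) (exprM (phN _) 2 2) subr_sqr phi_sqrB phi_sqrD.
by rewrite (exprM _ 2 2) -h; ring.
Qed.

(** Dissection writes the sum as [(a + b)(c - d) + (a - b)(c + d) = 2 (a c - b d)], where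
    [a c = phiA (4 * k)] and, by the cubic identity, [b d = phiA (4 * k) - phiB (4 * k)]. The next
    lemma uses [2 (a c + b d)] in the same way. *)
Lemma phi_crossD :
  ph k * phN (3 * k) + phN k * ph (3 * k) = 2 * phiB (4 * k).
Proof.
have k30 : (0 < 3 * k)%N by lia.
have k40 : (0 < 4 * k)%N by lia.
have := phiA_sub_phiB k40; rewrite /phiA => /eqP; rewrite subr_eq addrC -subr_eq => /eqP <-.
rewrite (phi1_dissection k0) (phiN1_dissection k0).
rewrite (phi1_dissection k30) (phiN1_dissection k30).
by rewrite !mulnA -[(3 * 4)%N]/(4 * 3)%N [(3 * k)%N]mulnC [(4 * k)%N]mulnC !exprM; ring.
Qed.

Lemma phiA_add_phiB : phiA k + phiB k = 2 * (2 * phiA (4 * k) - phiB (4 * k)).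
Proof.
have k30 : (0 < 3 * k)%N by lia.
have k40 : (0 < 4 * k)%N by lia.
have := phiA_sub_phiB k40 => /eqP; rewrite subr_eq addrC -subr_eq => /eqP <-.
rewrite /phiA /phiB (phi1_dissection k0) (phiN1_dissection k0).
rewrite (phi1_dissection k30) (phiN1_dissection k30).
by rewrite !mulnA -[(3 * 4)%N]/(4 * 3)%N [(3 * k)%N]mulnC [(4 * k)%N]mulnC !exprM; ring.
Qed.

Lemma phiA_phiB : phiA k * phiB k = phiB (2 * k) ^+ 2.
Proof.
have k30 : (0 < 3 * k)%N by lia.
have := phi1_phiN1 k0; have := phi1_phiN1 k30; rewrite /phiA /phiB => h3 h1.
by rewrite mulrACA h1 h3 -exprMn !mulnA.
Qed.

End ThetaRelations2.

Lemma coef0_phiN1 k : (0 < k)%N -> c (phN k) = 1.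
Proof.
move=> k0; have := congr1 c (phiN1_prod k0).
by rewrite !coef0E.
Qed.

Lemma coef0_phi1 k : (0 < k)%N -> c (ph k) = 1.
Proof.
move=> k0; have := congr1 c (phi1_prod k0).
by rewrite !coef0E.
Qed.

Lemma coef0_ps k : (0 < k)%N -> c (ps k) = 2.
Proof.
move=> k0; have := congr1 c (psi2_prod k0).
by rewrite !coef0E.
Qed.

(** * Successive square roots as eta quotients *)

Section EtaQuotients.
Variable k : nat.

(** At [k = 1], [pi_num / pi_den] is twice the square root of [psi(q^2)^3 phi(q^3)^3 / (psi(q^6)
    phi(q))]. Numerator and denominator are kept apart since the ring is only a domain. *)
Definition pi_num := 2 * (et k * et (4 * k) ^+ 4 * et (6 * k) ^+ 8).
Definition pi_den := et (2 * k) ^+ 4 * et (12 * k) ^+ 4 * et (3 * k) ^+ 3.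

(** The quotient [xi_num / xi_den] turns out to be [B(q^2) + B(q)] at [q^k]. *)
Definition xi_num := 2 * (et k * et (3 * k) * et (8 * k) ^+ 2 * et (12 * k) ^+ 4).
Definition xi_den := et (4 * k) ^+ 2 * et (24 * k) ^+ 2 * et (6 * k) ^+ 2.

Lemma coef0_pi_den : c pi_den = 1.
Proof. by rewrite /pi_den !coef0E. Qed.
Lemma coef0_xi_den : c xi_den = 1.
Proof. by rewrite /xi_den !coef0E. Qed.

End EtaQuotients.

Lemma pi_theta k : (0 < k)%N ->
  pi_num k ^+ 2 * ps (3 * k) * ph k = ps k ^+ 3 * ph (3 * k) ^+ 3 * pi_den k ^+ 2.
Proof.
move=> k0.
have key (F : fieldType) (x1 x2 x3 x4 x6 x12 : F) : x1 != 0 -> x2 != 0 -> x3 != 0 ->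
    x4 != 0 -> x6 != 0 -> x12 != 0 ->
    (2 * (x1 * x4 ^+ 4 * x6 ^+ 8)) ^+ 2 * (2 * x12 ^+ 2 / x6)
       * (x2 ^+ 5 / (x1 ^+ 2 * x4 ^+ 2))
    = (2 * x4 ^+ 2 / x2) ^+ 3 * (x6 ^+ 5 / (x3 ^+ 2 * x12 ^+ 2)) ^+ 3
       * (x2 ^+ 4 * x12 ^+ 4 * x3 ^+ 3) ^+ 2.
  by move=> *; field; apply/and5P; split=> //; apply/andP.
rewrite /pi_num /pi_den; apply: tofrac_inj.
rewrite !tofracE.
rewrite (@tofrac_phi1 k (2 * k) (4 * k)); [|lia..].
rewrite (@tofrac_ps k (2 * k) (4 * k)); [|lia..].
rewrite (@tofrac_phi1 (3 * k) (6 * k) (12 * k)); [|lia..].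
rewrite (@tofrac_ps (3 * k) (6 * k) (12 * k)); [|lia..].
by apply: key; rewrite tofrac_et_neq0.
Qed.

(* With D = A - B and P = pi_num / pi_den this is P - D A / P = 2 B. In terms of
   the moduli alpha, beta of degrees 1 and 3, P / A = (alpha^3 / beta)^(1/8) and
   D / P = (beta^3 / alpha)^(1/8), and the square of the equation amounts to the
   modular equation (alpha beta)^(1/4) + ((1 - alpha) (1 - beta))^(1/4) = 1. *)
Lemma pi_phiB k : (0 < k)%N -> let K := (2 * k)%N in
  pi_num K ^+ 2 - (phiA K - phiB K) * phiA K * pi_den K ^+ 2
  = 2 * phiB K * pi_num K * pi_den K.
Proof.
move=> k0 K; have K0 : (0 < K)%N by rewrite /K; lia.
have K30 : (0 < 3 * K)%N by lia.
apply: sqrf_c_inj; last first.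
  rewrite /phiA /phiB /pi_num /pi_den !coef0E.
  by rewrite !coef0_phi1 ?coef0_phiN1 //; lia.
have hD := phiA_sub_phiB K0; set D := phiA K - phiB K in hD *.
have D0 : D * phiA K != 0.
  have psn j : (0 < j)%N -> ps j != 0 by move=> j0; rewrite c_neq0 ?coef0_ps.
  have phn j : (0 < j)%N -> ph j != 0 by move=> j0; rewrite c_neq0 ?coef0_phi1.
  by rewrite hD /phiA !mulf_neq0 ?expf_neq0 ?psn ?phn.
have I1 := pi_theta K0; have qa := phi_quarticB k0.
have qc := @phi_quarticB (3 * k); rewrite (_ : 2 * (3 * k) = 3 * K)%N in qc; last by lia.
have {}qc := qc ltac:(lia); rewrite -/K [(3 * K)%N]mulnC exprM mulnC in qa qc.
move: (pi_num K) (pi_den K) I1 => N M I1.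
have BE : phiB K = phiA K - D by rewrite /D; ring.
(* The quartic identities for [q] and [q^3] multiply to a formula for [B^4] whose outer terms are
   [A^4] and [D^4]; [B = A - D] then evaluates the cross terms. *)
have e1 : (X ^+ K * ps K ^+ 4) * ph (3 * K) ^+ 4
    + ((X ^+ K) ^+ 3 * ps (3 * K) ^+ 4) * ph K ^+ 4
    = D * phiA K * (4 * phiA K ^+ 2 - 6 * phiA K * D + 4 * D ^+ 2).
  have e2 : phiB K ^+ 4 = (ph K ^+ 4 - X ^+ K * ps K ^+ 4)
      * (ph (3 * K) ^+ 4 - (X ^+ K) ^+ 3 * ps (3 * K) ^+ 4).
    by rewrite -qa -qc /phiB; ring.
  have e3 : D ^+ 4 = (X ^+ K * ps K ^+ 4) * ((X ^+ K) ^+ 3 * ps (3 * K) ^+ 4).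
    by rewrite hD; ring.
  have e4 : phiA K ^+ 4 = ph K ^+ 4 * ph (3 * K) ^+ 4 by rewrite /phiA; ring.
  transitivity (phiA K ^+ 4 + D ^+ 4 - phiB K ^+ 4); first by rewrite e2 e3 e4; ring.
  by rewrite BE; ring.
(* By [pi_theta] the two cross terms are [D A N^2 / M^2] and [D^3 A^3 M^2 / N^2]; [D A] is then
   cancelled. *)
have e5 : N ^+ 4 + D ^+ 2 * phiA K ^+ 2 * M ^+ 4
    = (4 * phiA K ^+ 2 - 6 * phiA K * D + 4 * D ^+ 2) * (N ^+ 2 * M ^+ 2).
  apply: (mulfI D0); rewrite [RHS]mulrA -e1.
  transitivity (X ^+ K * ps K * ph (3 * K) * (N ^+ 2 * ps (3 * K) * ph K) * N ^+ 2
    + (X ^+ K * ps (3 * K) * ph K) ^+ 3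
       * (ps K ^+ 3 * ph (3 * K) ^+ 3 * M ^+ 2) * M ^+ 2).
    by rewrite hD /phiA; ring.
  by rewrite I1 -[in X in _ + X]I1; ring.
transitivity ((N ^+ 4 + D ^+ 2 * phiA K ^+ 2 * M ^+ 4)
   - 2 * (D * phiA K) * (N ^+ 2 * M ^+ 2)); first by ring.
by rewrite e5 BE; ring.
Qed.

(** By [phi_sqrD], [4 A(q^2)^2] is a product of two sums of squares; its mixed terms are the square
    of [phi_crossD] less [2 A B]. Both [A(q^2) B(q^2) = B(q^4)^2] and [B(q^2)^2 = A B] finish the
    expansion. *)
Lemma phiA_phiB_sqr k : (0 < k)%N -> let K := (2 * k)%N in
  (2 * phiA (2 * K) - phiB (2 * K)) ^+ 2
  = phiA K ^+ 2 - phiA K * phiB K + phiB K ^+ 2.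
Proof.
move=> k0 K; have K0 : (0 < K)%N by rewrite /K; lia.
have s1 := phi_sqrD k0; have s3 := @phi_sqrD (3 * k).
rewrite (_ : 2 * (3 * k) = 3 * K)%N in s3; last by lia.
rewrite (_ : 4 * (3 * k) = 3 * (2 * K))%N in s3; last by lia.
have {}s3 := s3 ltac:(lia); rewrite -/K (_ : 4 * k = 2 * K)%N in s1; last by lia.
have cross := phi_crossD K0; have S := phiA_phiB K0.
have T := @phiA_phiB (2 * K) ltac:(lia); rewrite mulnA in T.
have e : 4 * phiA (2 * K) ^+ 2
    = (phiA K ^+ 2 + phiB K ^+ 2) + 4 * phiB (4 * K) ^+ 2 - 2 * (phiA K * phiB K).
  transitivity ((2 * ph (2 * K) ^+ 2) * (2 * ph (3 * (2 * K)) ^+ 2)).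
    by rewrite /phiA; ring.
  rewrite -s1 -s3; transitivity ((phiA K ^+ 2 + phiB K ^+ 2)
     + (2 * phiB (4 * K)) ^+ 2 - 2 * (phiA K * phiB K)); last by ring.
  by rewrite -cross /phiA /phiB; ring.
transitivity (4 * phiA (2 * K) ^+ 2 - 4 * (phiA (2 * K) * phiB (2 * K)) + phiB (2 * K) ^+ 2).
  by ring.
by rewrite e T -S; ring.
Qed.

(** By [pi_phiB], [(P - B)^2 = D A + B^2 = A^2 - A B + B^2], which is the square just computed. *)
Lemma phiA_phiB_pi k : (0 < k)%N -> let K := (2 * k)%N in
  (2 * phiA (2 * K) - phiB (2 * K) + phiB K) * pi_den K = pi_num K.
Proof.
move=> k0 K; have K0 : (0 < K)%N by rewrite /K; lia.
have h1 := pi_phiB k0; have h2 := phiA_phiB_sqr k0; rewrite -/K in h1 h2.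
suff e : (2 * phiA (2 * K) - phiB (2 * K)) * pi_den K = pi_num K - phiB K * pi_den K.
  by rewrite mulrDl e subrK.
apply: sqrf_c_inj.
  rewrite exprMn h2; transitivity ((pi_num K ^+ 2
     - (phiA K - phiB K) * phiA K * pi_den K ^+ 2) - 2 * phiB K * pi_num K * pi_den K
     + (phiA K ^+ 2 - phiA K * phiB K + phiB K ^+ 2) * pi_den K ^+ 2).
    by rewrite h1; ring.
  by ring.
rewrite /phiA /phiB /pi_num /pi_den !coef0E.
by rewrite !coef0_phi1 ?coef0_phiN1 //; lia.
Qed.

(** As [B(q^2)^2 = A B], the square of the sum is [B (A + B + 2 B(q^2))], and [phiA_add_phiB] turns
    it into [2 B(q) P(q^2)], an eta quotient. *)
Lemma phiB_xi k : (0 < k)%N -> (phiB (2 * k) + phiB k) * xi_den k = xi_num k.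
Proof.
move=> k0; have k20 : (0 < 2 * k)%N by lia.
apply: sqrf_c_inj; last first.
  rewrite /phiB /xi_num /xi_den !coef0E.
  by rewrite !coef0_phiN1 //; lia.
have key (F : fieldType) (x1 x2 x3 x4 x6 x8 x12 x24 : F) : x1 != 0 -> x2 != 0 ->
    x3 != 0 -> x4 != 0 -> x6 != 0 -> x8 != 0 -> x12 != 0 -> x24 != 0 ->
    2 * (x1 ^+ 2 / x2 * (x3 ^+ 2 / x6)) * (2 * (x2 * x8 ^+ 4 * x12 ^+ 8))
      * (x4 ^+ 2 * x24 ^+ 2 * x6 ^+ 2) ^+ 2
    = (2 * (x1 * x3 * x8 ^+ 2 * x12 ^+ 4)) ^+ 2 * (x4 ^+ 4 * x24 ^+ 4 * x6 ^+ 3).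
  by move=> *; field; apply/andP.
have I2 : 2 * phiB k * pi_num (2 * k) * xi_den k ^+ 2 = xi_num k ^+ 2 * pi_den (2 * k).
  apply: tofrac_inj; rewrite /pi_num /pi_den /xi_num /xi_den /phiB.
  rewrite !mulnA -[(2 * 2)%N]/(4%N) -[(4 * 2)%N]/(8%N) -[(6 * 2)%N]/(12%N)
    -[(12 * 2)%N]/(24%N) -[(3 * 2)%N]/(6%N).
  rewrite !tofracE.
  rewrite (@tofrac_phiN1 k (2 * k)); [|lia..].
  rewrite (@tofrac_phiN1 (3 * k) (6 * k)); [|lia..].
  by apply: key; rewrite tofrac_et_neq0.
have den0 : pi_den (2 * k) != 0 by apply: c_neq0; rewrite coef0_pi_den.
apply: (mulIf den0); rewrite -I2 -(phiA_phiB_pi k0).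
have := phiA_add_phiB k0; have := phiA_phiB k0; rewrite mulnA => h1 h2.
transitivity ((phiB (2 * k) ^+ 2 + 2 * (phiB (2 * k) * phiB k) + phiB k ^+ 2)
   * (xi_den k ^+ 2 * pi_den (2 * k))); first by ring.
rewrite -h1; transitivity (phiB k * ((phiA k + phiB k) + 2 * phiB (2 * k))
   * (xi_den k ^+ 2 * pi_den (2 * k))); first by ring.
by rewrite h2; ring.
Qed.

(** Replacing [phi(-q^2)^2] and [phi(-q^6)^2] by [phi1_phiN1], the square of the sum becomes
    [2 B(q) (B(q^4) + B(q^2))], to which [phiB_xi] applies. *)
Lemma phiN1_mixed k : (0 < k)%N ->
  (phN k * phN (6 * k) + phN (2 * k) * phN (3 * k))
    * (et (8 * k) * et (12 * k) * et (48 * k))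
  = 2 * (et k * et (3 * k) * et (16 * k) * et (24 * k) ^+ 2).
Proof.
move=> k0; have k20 : (0 < 2 * k)%N by lia.
have k30 : (0 < 3 * k)%N by lia.
apply: sqrf_c_inj; last first.
  by rewrite !coef0E !coef0_phiN1 //; lia.
have key (F : fieldType) (x1 x2 x3 x6 x8 x12 x16 x24 x48 : F) :
    x1 != 0 -> x2 != 0 -> x3 != 0 -> x6 != 0 -> x8 != 0 -> x12 != 0 ->
    x16 != 0 -> x24 != 0 -> x48 != 0 ->
    2 * (x1 ^+ 2 / x2 * (x3 ^+ 2 / x6)) * (2 * (x2 * x6 * x16 ^+ 2 * x24 ^+ 4))
      * (x8 * x12 * x48) ^+ 2
    = (2 * (x1 * x3 * x16 * x24 ^+ 2)) ^+ 2 * (x8 ^+ 2 * x48 ^+ 2 * x12 ^+ 2).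
  by move=> *; field; apply/andP.
have I3 : 2 * phiB k * xi_num (2 * k) * (et (8 * k) * et (12 * k) * et (48 * k)) ^+ 2
    = (2 * (et k * et (3 * k) * et (16 * k) * et (24 * k) ^+ 2)) ^+ 2 * xi_den (2 * k).
  apply: tofrac_inj; rewrite /xi_num /xi_den /phiB.
  rewrite !mulnA -[(3 * 2)%N]/(6%N) -[(8 * 2)%N]/(16%N) -[(12 * 2)%N]/(24%N) -[(4 * 2)%N]/(8%N)
    -[(24 * 2)%N]/(48%N) -[(6 * 2)%N]/(12%N).
  rewrite !tofracE.
  rewrite (@tofrac_phiN1 k (2 * k)); [|lia..].
  rewrite (@tofrac_phiN1 (3 * k) (6 * k)); [|lia..].
  by apply: key; rewrite tofrac_et_neq0.
have den0 : xi_den (2 * k) != 0 by apply: c_neq0; rewrite coef0_xi_den.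
apply: (mulIf den0); rewrite -I3 -(phiB_xi k20).
have h1 := phi1_phiN1 k0; have h3 := phi1_phiN1 k30; have cross := phi_crossD k0.
rewrite !mulnA -[(2 * 3)%N]/(6%N) -[(2 * 2)%N]/(4%N) in h3 *.
move: (et _ * _ * _) (xi_den _) => E M.
transitivity ((phN k ^+ 2 * phN (6 * k) ^+ 2
   + phN (2 * k) ^+ 2 * phN (3 * k) ^+ 2
   + 2 * phiB k * (phN (2 * k) * phN (6 * k))) * (E ^+ 2 * M)).
  by rewrite /phiB; ring.
rewrite -h1 -h3.
transitivity (phiB k * ((ph k * phN (3 * k) + phN k * ph (3 * k))
   + 2 * (phN (2 * k) * phN (6 * k))) * (E ^+ 2 * M)).
  by rewrite /phiB; ring.
have B2 : phiB (2 * k) = phN (2 * k) * phN (6 * k) by rewrite /phiB mulnA.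
by rewrite cross B2; ring.
Qed.

Lemma eta_identity :
  et 1 ^+ 2 * et 6 ^+ 3 * et 4 * et 8 * et 48 + et 2 ^+ 3 * et 12 * et 3 ^+ 2 * et 8 * et 48
  = 2 * (et 1 * et 3 * et 16 * et 24 ^+ 2 * et 2 * et 4 * et 6).
Proof.
have h : (phN 1 * phN 6 + phN 2 * phN 3) * (et 8 * et 12 * et 48)
    = 2 * (et 1 * et 3 * et 16 * et 24 ^+ 2) := @phiN1_mixed 1 isT.
have h1 : phN 1 * et 2 = et 1 ^+ 2 := @phiN1_prod 1 isT.
have h2 : phN 2 * et 4 = et 2 ^+ 2 := @phiN1_prod 2 isT.
have h3 : phN 3 * et 6 = et 3 ^+ 2 := @phiN1_prod 3 isT.
have h6 : phN 6 * et 12 = et 6 ^+ 2 := @phiN1_prod 6 isT.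
apply: (mulIf (et_neq0 12)).
transitivity (((phN 1 * et 2) * (phN 6 * et 12) * (et 4 * et 6)
  + (phN 2 * et 4) * (phN 3 * et 6) * (et 2 * et 12)) * (et 8 * et 12 * et 48)).
  by rewrite h1 h2 h3 h6; ring.
transitivity ((phN 1 * phN 6 + phN 2 * phN 3) * (et 8 * et 12 * et 48)
  * (et 2 * et 12 * et 4 * et 6)); first by ring.
by rewrite h; ring.
Qed.

End ThetaAlgebra.

Theorem eta_fps_identity :
  eta 1 ^+ 2 * eta 6 ^+ 3 * eta 4 * eta 8 * eta 48
    + eta 2 ^+ 3 * eta 12 * eta 3 ^+ 2 * eta 8 * eta 48
  = 2 * (eta 1 * eta 3 * eta 16 * eta 24 ^+ 2 * eta 2 * eta 4 * eta 6).
Proof.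
apply: (@eta_identity (fps int) fps_coef0 fpsX eta (phi 1) (phi (-1)) psi2).
- by rewrite -[fpsX]expr1 fpsXn_neq0.
- exact: eta_coef0.
- exact: phiN1_prod.
- exact: phi1_prod.
- exact: psi2_prod.
- by move=> k k0; rewrite (phi_dissection k0 (expr1n _ 2)) rmorph1 mul1r.
- move=> k k0.
  by rewrite (phi_dissection k0 (sqrrN 1)) polyCN rmorphN rmorph1 mulN1r mulNr.
- exact: phi_cubic.
Qed.

(** * Passage to complex numbers *)

Section NumFieldLimits.
Local Open Scope classical_set_scope.
Variable K : numFieldType.
Implicit Types (u : nat -> K) (l : K).

Lemma cvgn_epsP u l : u @ \oo --> l <->
  forall e, 0 < e -> exists N, forall n, (N <= n)%N -> `|l - u n| < e.
Proof.
split=> [/cvgrPdist_lt h e e0|h].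
  by have [N _ hN] := h e e0; exists N => n; exact: hN.
by apply/cvgrPdist_lt => e /h[N hN]; exists N.
Qed.

Lemma limn_unique u l l' : u @ \oo --> l -> u @ \oo --> l' -> l = l'.
Proof. by move=> h h'; apply: (cvg_unique _ h h'); exact: norm_hausdorff. Qed.

Lemma cvgn_prod (I : eqType) (s : seq I) (u : I -> nat -> K) (l : I -> K) :
  {in s, forall i, u i @ \oo --> l i} ->
  (fun n => \prod_(i <- s) u i n) @ \oo --> \prod_(i <- s) l i.
Proof.
elim: s => [_|i s IH h].
  by rewrite big_nil; under eq_fun do rewrite big_nil; exact: cvg_cst.
rewrite big_cons; under eq_fun do rewrite big_cons.
apply: cvgM; first by apply: h; rewrite mem_head.
by apply: IH => j js; apply: h; rewrite in_cons js orbT.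
Qed.

Lemma cvgn_sum (I : eqType) (s : seq I) (u : I -> nat -> K) (l : I -> K) :
  {in s, forall i, u i @ \oo --> l i} ->
  (fun n => \sum_(i <- s) u i n) @ \oo --> \sum_(i <- s) l i.
Proof.
elim: s => [_|i s IH h].
  by rewrite big_nil; under eq_fun do rewrite big_nil; exact: cvg_cst.
rewrite big_cons; under eq_fun do rewrite big_cons.
apply: cvgD; first by apply: h; rewrite mem_head.
by apply: IH => j js; apply: h; rewrite in_cons js orbT.
Qed.

End NumFieldLimits.

(** * Uniform bounds for real partial products *)

Section RealProducts.
Variables (R : realType) (y : R).
Hypotheses (y0 : 0 <= y) (y1 : y < 1).

Lemma prod_geometric_le c N : 0 <= c ->
  \prod_(i < N) (1 + c * y ^+ i.+1) <= expR (c / (1 - y)).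
Proof.
move=> c0; have d0 : 0 < 1 - y by rewrite subr_gt0.
(* The induction needs the partial geometric sum; each step is [1 + x <= expR x]. *)
suff h : \prod_(i < N) (1 + c * y ^+ i.+1) <= expR (c * ((1 - y ^+ N) / (1 - y))).
  apply: (le_trans h); rewrite ler_expR ler_wpM2l // ler_pdivrMr // mulVf ?gt_eqF //.
  by rewrite lerBlDr lerDl exprn_ge0.
elim: N => [|N IH]; first by rewrite big_ord0 expr0 subrr mul0r mulr0 expR0.
have -> : c * ((1 - y ^+ N.+1) / (1 - y)) = c * ((1 - y ^+ N) / (1 - y)) + c * y ^+ N.
  by rewrite exprS; field; rewrite gt_eqF.
rewrite big_ord_recr /= expRD; apply: ler_pM => //.
- by apply: prodr_ge0 => i _; rewrite addr_ge0 ?mulr_ge0 ?exprn_ge0.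
- by rewrite addr_ge0 ?mulr_ge0 ?exprn_ge0.
apply: le_trans (expR_ge1Dx _); rewrite lerD2l ler_wpM2l //.
by rewrite exprS ler_piMl ?exprn_ge0 // ltW.
Qed.

(** For [0 <= t <= y], [1 / (1 - t) <= 1 + t / (1 - y)], so the upper bound applies to the inverse
    product. This keeps the infinite products away from 0. *)
Lemma prod_geometric_ge : exists2 d : R, 0 < d &
  forall N, d <= \prod_(i < N) (1 - y ^+ i.+1).
Proof.
have d0 : 0 < 1 - y by rewrite subr_gt0.
exists (expR ((1 - y)^-1 / (1 - y)))^-1; first by rewrite invr_gt0 expR_gt0.
move=> N; rewrite invf_ple ?posrE ?expR_gt0 //; last first.
  by apply: prodr_gt0 => i _; rewrite subr_gt0 exprn_ilt1.
have c0 : 0 <= (1 - y)^-1 by rewrite invr_ge0 ltW.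
apply: le_trans (prod_geometric_le N c0); rewrite -prodfV.
apply: ler_prod => i _; have t1 : y ^+ i.+1 < 1 by rewrite exprn_ilt1.
have t0 : 0 <= y ^+ i.+1 by rewrite exprn_ge0.
have ty : y ^+ i.+1 <= y by rewrite exprS ler_piMr // exprn_ile1 // ltW.
rewrite invr_ge0 subr_ge0 ltW //= -div1r ler_pdivrMr ?subr_gt0 //.
set t := y ^+ i.+1 in t0 t1 ty *.
have -> : (1 + (1 - y)^-1 * t) * (1 - t) = 1 + (1 - y)^-1 * (t * (y - t)).
  by field; rewrite gt_eqF.
by rewrite lerDl !mulr_ge0 // subr_ge0.
Qed.

End RealProducts.

(** * Coefficientwise majorants of integer polynomials *)

Section Majorants.
Implicit Types p h : {poly int}.

Definition poly_maj p h := forall i, `|p`_i| <= h`_i.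

Lemma poly_majM p h p' h' : poly_maj p h -> poly_maj p' h' -> poly_maj (p * p') (h * h').
Proof.
move=> mp mp' i; rewrite !coefM; apply: le_trans (ler_norm_sum _ _ _) _.
by apply: ler_sum => j _; rewrite normrM; apply: ler_pM.
Qed.

Lemma poly_majD p h p' h' : poly_maj p h -> poly_maj p' h' -> poly_maj (p + p') (h + h').
Proof.
by move=> mp mp' i; rewrite !coefD; apply: le_trans (ler_normD _ _) (lerD _ _).
Qed.

Lemma poly_maj_int (c : int) : poly_maj c%:~R `|c|%:~R.
Proof.
have intrC (a : int) : a%:~R = a%:P :> {poly int} by rewrite -[in RHS](intz a) rmorph_int.
by move=> i; rewrite !intrC !coefC; case: eqP => // _; rewrite normr0.
Qed.

Lemma poly_maj_prod (I : Type) (s : seq I) (p h : I -> {poly int}) :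
  (forall i, poly_maj (p i) (h i)) -> poly_maj (\prod_(i <- s) p i) (\prod_(i <- s) h i).
Proof.
move=> m; elim: s => [|i s IH]; last by rewrite !big_cons; exact: poly_majM.
by rewrite !big_nil => i; rewrite coef1; case: eqP.
Qed.

Lemma poly_maj_sum (I : Type) (s : seq I) (p h : I -> {poly int}) :
  (forall i, poly_maj (p i) (h i)) -> poly_maj (\sum_(i <- s) p i) (\sum_(i <- s) h i).
Proof.
move=> m; elim: s => [|i s IH]; last by rewrite !big_cons; exact: poly_majD.
by rewrite !big_nil => i; rewrite coef0 normr0.
Qed.

Lemma poly_maj_1B n : poly_maj (1 - 'X^n) (1 + 'X^n).
Proof.
move=> i; rewrite coefB coefD coef1 coefXn.
by apply: le_trans (ler_normB _ _) _; rewrite !normr_nat.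
Qed.

End Majorants.

(** * Convergence of complex sequences through real and imaginary parts *)

Section ComplexLimits.
Local Open Scope classical_set_scope.
Variable R : realType.
Implicit Types (u : nat -> R[i]) (z : R[i]).
Local Notation C := (R[i] : numFieldType).

Lemma cvgn_complexP u (l : R[i]) :
  (forall e : R, 0 < e -> exists N, forall n, (N <= n)%N -> `|l - u n| < e%:C) ->
  (u : nat -> C) @ \oo --> (l : C).
Proof.
move=> h; apply/(@cvgn_epsP C) => e; rewrite ltcE => /andP[/eqP /= e1 e2].
have [N hN] := h _ e2; exists N => n /hN.
by have -> : e = (complex.Re e)%:C by case: e e1 e2 {hN} => a b /= -> _.
Qed.

Lemma Im_norm_le z : `|complex.Im z|%:C <= `|z|.
Proof.
by rewrite normc_def lecR -sqrtr_sqr ler_wsqrtr // lerDr sqr_ge0.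
Qed.

Lemma norm_complex_le z : `|z| <= (`|complex.Re z| + `|complex.Im z|)%:C.
Proof.
rewrite normc_def lecR -[leRHS]ger0_norm ?addr_ge0 // -sqrtr_sqr ler_wsqrtr //.
rewrite sqrrD !real_normK ?num_real // addrAC lerDl.
by rewrite mulrn_wge0 // mulr_ge0.
Qed.

Lemma real_geometric_cvg (a : nat -> R) (B r : R) : 0 <= B -> 0 <= r -> r < 1 ->
  (forall n, `|a n.+1 - a n| <= B * r ^+ n) -> exists l : R, a @ \oo --> l.
Proof.
move=> B0 r0 r1 h; suff : cvgn a by move=> /cvg_ex.
have -> : a = (fun n => a 0%N + series (telescope a) n).
  by apply/funext => n; exact: eq_sum_telescope.
apply: is_cvgD; first exact: is_cvg_cst.
apply: normed_cvg; apply: (@series_le_cvg _ _ (geometric B r)).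
- by move=> n /=.
- by move=> n /=; rewrite mulr_ge0 ?exprn_ge0.
- by move=> n /=; exact: h.
- by apply: is_cvg_geometric_series; rewrite ger0_norm.
Qed.

Lemma geometric_cvg u (B r : R) : 0 <= B -> 0 <= r -> r < 1 ->
  (forall n, `|u n.+1 - u n| <= (B * r ^+ n)%:C) ->
  exists l : C, (u : nat -> C) @ \oo --> l.
Proof.
move=> B0 r0 r1 h.
have [|x hx] := @real_geometric_cvg (fun n => complex.Re (u n)) B r B0 r0 r1.
  move=> n; rewrite -lecR; apply: le_trans (h n); rewrite -raddfB.
  exact: normc_ge_Re.
have [|y hy] := @real_geometric_cvg (fun n => complex.Im (u n)) B r B0 r0 r1.
  move=> n; rewrite -lecR; apply: le_trans (h n); rewrite -raddfB.
  exact: Im_norm_le.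
exists (x +i* y); apply: cvgn_complexP => e e0.
have e2 : 0 < e / 2 by rewrite divr_gt0.
have [N1 h1] := (cvgn_epsP _ _).1 hx _ e2; have [N2 h2] := (cvgn_epsP _ _).1 hy _ e2.
exists (maxn N1 N2) => n; rewrite geq_max => /andP[/h1 {}h1 /h2 {}h2].
apply: le_lt_trans (norm_complex_le _) _; rewrite ltcR [e]splitr.
by move: h1 h2; case: (u n) => a b /= h1 h2; rewrite ltrD.
Qed.

End ComplexLimits.

Definition eta_poly k N : {poly int} := \prod_(i < N) (1 - 'X^(k * i.+1)).
Definition eta_maj k N : {poly int} := \prod_(i < N) (1 + 'X^(k * i.+1)).

Lemma eta_poly_eqm k N : (0 < k)%N ->
  fps_eqm N.+1 (fps_of_poly (eta_poly k N)) (eta k).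
Proof.
move=> k0; rewrite rmorph_prod.
have -> : \prod_(i < N) fps_of_poly (1 - 'X^(k * i.+1)) = qfact (fpsX ^+ k) N :> fps int.
  by rewrite /qfact; apply: eq_bigr => i _; rewrite rmorphB rmorph1 -exprM fpsXnE.
by apply/fps_eqm_sym/eta_eqm.
Qed.

Section EulerProduct.
Local Open Scope classical_set_scope.
Variables (R : realType) (x : R[i]) (r : R).
Hypotheses (xr : `|x| = r%:C) (r1 : r < 1).
Local Notation C := (R[i] : numFieldType).

Let r0 : 0 <= r. Proof. by rewrite -ler0c -xr. Qed.

Lemma euler_prod_norm_le N :
  `|\prod_(i < N) (1 - x ^+ i.+1)| <= (expR (1 / (1 - r)))%:C.
Proof.
rewrite normr_prod; apply: (@le_trans _ _ (\prod_(i < N) (1 + 1 * r ^+ i.+1))%:C).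
  rewrite rmorph_prod; apply: ler_prod => i _; rewrite normr_ge0 /=.
  apply: le_trans (ler_normB _ _) _.
  by rewrite normr1 normrX xr rmorphD rmorph1 mul1r rmorphXn.
by rewrite lecR; exact: prod_geometric_le.
Qed.

(** Increments are bounded by a constant times [r^n]; the limit is nonzero because the partial
    products dominate in modulus those of [1 - r^(i+1)]. *)
Lemma euler_prod_cvg : exists2 l : C, l != 0 &
  (fun N => \prod_(i < N) (1 - x ^+ i.+1) : C) @ \oo --> l.
Proof.
have [l hl] : exists l : C, (fun N => \prod_(i < N) (1 - x ^+ i.+1) : C) @ \oo --> l.
  apply: (@geometric_cvg _ _ (expR (1 / (1 - r))) r) => //.
  move=> n; rewrite big_ord_recr /= mulrBr mulr1 addrC addrA addNr add0r normrN normrM.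
  rewrite rmorphM; apply: ler_pM => //; first exact: euler_prod_norm_le.
  by rewrite normrX xr -rmorphXn lecR exprS ler_piMl ?exprn_ge0 // ltW.
exists l => //; apply/eqP => l0; rewrite l0 in hl.
have [d d0 hd] := prod_geometric_ge r0 r1.
have dC : 0 < d%:C :> R[i] by rewrite ltcR.
have [N hN] := (@cvgn_epsP C _ _).1 hl _ dC.
have := hN N (leqnn N); rewrite sub0r normrN => /(le_lt_trans _) => /(_ d%:C).
rewrite ltxx => h; suff : false by []. apply: h.
apply: (@le_trans _ _ (\prod_(i < N) (1 - r ^+ i.+1))%:C); first by rewrite lecR.
rewrite normr_prod rmorph_prod; apply: ler_prod => i _ /=.
rewrite ler0c subr_ge0 exprn_ile1 ?(ltW r1) //=.
apply: le_trans (lerB_dist _ _).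
by rewrite normr1 normrX xr rmorphB rmorph1 rmorphXn.
Qed.

End EulerProduct.

(** * From formal relations to complex [q] *)

Section Transfer.
Local Open Scope classical_set_scope.
Variables (R : realType) (q : R[i]) (r : R).
Hypotheses (qr : `|q| = r%:C) (r1 : r < 1).
Local Notation C := (R[i] : numFieldType).

Let r0 : 0 <= r. Proof. by rewrite -ler0c -qr. Qed.

Lemma f_cvg k : (0 < k)%N -> f (q : C) k != 0 /\
  (fun N => \prod_(i < N) (1 - q ^+ (k * i.+1)) : C) @ \oo --> f (q : C) k.
Proof.
move=> k0; have qk : `|q ^+ k| = (r ^+ k)%:C by rewrite normrX qr rmorphXn.
have rk1 : r ^+ k < 1 by rewrite exprn_ilt1 // -lt0n.
have [l l0 hl] := euler_prod_cvg qk rk1.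
have e : (fun N => \prod_(i < N) (1 - (q ^+ k) ^+ i.+1) : C)
       = (fun N => \prod_(i < N) (1 - q ^+ (k * i.+1)) : C).
  by apply/funext => N; apply: eq_bigr => i _; rewrite exprM.
suff -> : f (q : C) k = l by rewrite -e.
rewrite /f /qpochhammer_inf; apply/cvg_lim => //.
have -> : (fun N => \prod_(0 <= i < N) (1 - q ^+ k * (q ^+ k) ^+ i) : C)
        = (fun N => \prod_(i < N) (1 - (q ^+ k) ^+ i.+1) : C).
  by apply/funext => N; rewrite big_mkord; apply: eq_bigr => i _; rewrite exprS.
exact: hl.
Qed.

Let ev : {rmorphism {poly int} -> R[i]} :=
  [the {rmorphism {poly int} -> R[i]} of horner_eval q \o map_poly intr].
Let ev_real (s : R) : {rmorphism {poly int} -> R} :=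
  [the {rmorphism {poly int} -> R} of horner_eval s \o map_poly intr].

(** For [i >= N], [r^i = (r / s)^i s^i <= (r / s)^N s^i]; lower terms vanish. *)
Lemma ev_maj_le (p h : {poly int}) (s : R) N : poly_maj p h -> 0 < s -> r <= s ->
  (forall i, (i < N)%N -> p`_i = 0) -> `|ev p| <= ((r / s) ^+ N * ev_real s h)%:C.
Proof.
move=> m s0 rs low; pose n := maxn (size p) (size h).
have hn : 0 <= r / s by rewrite divr_ge0 // ltW.
have le1 : r / s <= 1 by rewrite ler_pdivrMr ?mul1r.
rewrite /ev /ev_real /= /horner_eval.
have szp : (size (map_poly intr p : {poly R[i]}) <= n)%N.
  by apply: leq_trans (size_poly _ _) (leq_maxl _ _).
have szh : (size (map_poly intr h : {poly R}) <= n)%N.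
  by apply: leq_trans (size_poly _ _) (leq_maxr _ _).
rewrite (horner_coef_wide _ szp) (horner_coef_wide _ szh).
apply: le_trans (ler_norm_sum _ _ _) _; rewrite mulr_sumr rmorph_sum.
apply: ler_sum => i _; rewrite !coef_map /= normrM normrX qr.
have -> : `|(p`_i)%:~R| = (`|p`_i|%:~R)%:C :> R[i] by rewrite rmorph_int intr_norm.
rewrite -rmorphXn -rmorphM lecR.
have [lt|le] := ltnP i N.
  rewrite low // normr0 mul0r !mulr_ge0 ?exprn_ge0 ?(ltW s0) //.
  by rewrite ler0z; apply: le_trans (m i).
have -> : r ^+ i = (r / s) ^+ i * s ^+ i by rewrite -exprMn mulfVK ?gt_eqF.
rewrite mulrCA; apply: ler_pM; rewrite ?exprn_ge0 // ?mulr_ge0 ?exprn_ge0 ?(ltW s0) ?ler0z //.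
  by rewrite ler_wiXn2l.
by rewrite ler_wpM2r ?exprn_ge0 ?(ltW s0) // ler_int.
Qed.

Lemma ev_eta_maj_le (s : R) k N : (0 < k)%N -> 0 <= s -> s < 1 ->
  0 <= ev_real s (eta_maj k N) <= expR (1 / (1 - s)).
Proof.
move=> k0 s0 s1; rewrite rmorph_prod; apply/andP; split.
  apply: prodr_ge0 => i _; rewrite rmorphD rmorph1 rmorphXn.
  by rewrite addr_ge0 // exprn_ge0 //= map_polyX /horner_eval hornerX.
apply: le_trans (@prod_geometric_le _ s s0 s1 1 N ler01); apply: ler_prod => i _.
rewrite rmorphD rmorph1 rmorphXn /= map_polyX /horner_eval hornerX mul1r.
rewrite addr_ge0 ?exprn_ge0 //= lerD2l ler_wiXn2l ?(ltW s1) //.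
by rewrite leq_pmull.
Qed.

(** A polynomial relation as a list of monomials: an integer coefficient and the indices of its
    factors, with repetition. *)
Variable L : seq (int * seq nat).
Hypothesis L0 : all (fun t => all (ltn 0) t.2) L.

Definition eta_comb N : {poly int} := \sum_(t <- L) t.1%:~R * \prod_(k <- t.2) eta_poly k N.
Definition eta_comb_maj N : {poly int} := \sum_(t <- L) `|t.1|%:~R * \prod_(k <- t.2) eta_maj k N.

Lemma eta_comb_majP N : poly_maj (eta_comb N) (eta_comb_maj N).
Proof.
apply: poly_maj_sum => t; apply: poly_majM; first exact: poly_maj_int.
by apply: poly_maj_prod => k; apply: poly_maj_prod => i; exact: poly_maj_1B.
Qed.

Lemma eta_comb_low N : \sum_(t <- L) t.1%:~R * \prod_(k <- t.2) eta k = 0 ->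
  forall i, (i < N)%N -> (eta_comb N)`_i = 0.
Proof.
move=> L_eq i lti; have : fps_eqm N (fps_of_poly (eta_comb N)) 0.
  rewrite -L_eq rmorph_sum; elim: L L0 => [|t l IH]; first by rewrite !big_nil.
  move=> /= /andP[t0 /IH {}IH]; rewrite !big_cons; apply: fps_eqmD => //.
  rewrite rmorphM; apply: fps_eqmM.
    by rewrite rmorph_int.
  rewrite rmorph_prod; elim: (t.2) t0 => [|k s IHs]; first by rewrite !big_nil.
  move=> /= /andP[k0 /IHs {}IHs]; rewrite !big_cons; apply: fps_eqmM => //.
  by move=> j ltj; apply: eta_poly_eqm => //; rewrite ltnS ltnW.
by move/(_ i lti).
Qed.

Lemma ev_eta_comb_maj_le (s : R) : 0 <= s -> s < 1 ->
  exists2 B, 0 <= B & forall N, ev_real s (eta_comb_maj N) <= B.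
Proof.
move=> s0 s1; exists (\sum_(t <- L) `|t.1|%:~R * \prod_(k <- t.2) expR (1 / (1 - s))).
  by apply: sumr_ge0 => t _; rewrite mulr_ge0 ?ler0z // prodr_ge0 // => k _; exact: expR_ge0.
move=> N; have maj_le k k0 := @ev_eta_maj_le s k N k0 s0 s1.
move: (ev_real s) maj_le => E maj_le; rewrite rmorph_sum.
elim: L L0 => [|t l IH]; first by rewrite !big_nil.
move=> /= /andP[t0 /IH {}IH]; rewrite !big_cons; apply: lerD => //.
rewrite rmorphM rmorph_int ler_wpM2l ?ler0z //.
rewrite rmorph_prod [leRHS]big_seq [leLHS]big_seq; apply: ler_prod => k /(allP t0) k0.
exact: maj_le.
Qed.

(** The values at [q] of the relation between partial products tend to the relation between the
    [f q k], and also to 0. *)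
Lemma eta_transfer : \sum_(t <- L) t.1%:~R * \prod_(k <- t.2) eta k = 0 ->
  \sum_(t <- L) t.1%:~R * \prod_(k <- t.2) f (q : C) k = 0.
Proof.
move=> L_eq; apply: (@limn_unique C (fun N => ev (eta_comb N))).
  have evE N : ev (eta_comb N) = \sum_(t <- L) t.1%:~R *
      \prod_(k <- t.2) \prod_(i < N) (1 - q ^+ (k * i.+1)).
    have evX : ev 'X = q by rewrite /ev /= map_polyX /horner_eval hornerX.
    move: (ev) evX => E evX; rewrite rmorph_sum; apply: eq_bigr => t _; rewrite rmorphM.
    congr (_ * _); first by rewrite rmorph_int.
    rewrite rmorph_prod; apply: eq_bigr => k _; rewrite rmorph_prod.
    apply: eq_bigr => i _; by rewrite rmorphB rmorph1 rmorphXn evX.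
  under eq_fun do rewrite evE.
  apply: (@cvgn_sum C) => t tL; apply: (@cvgM C); first exact: cvg_cst.
  apply: (@cvgn_prod C) => k kt; apply: (f_cvg _).2.
  exact: (allP (allP L0 t tL) k kt).
(* A radius strictly between [r] and 1: the majorants stay bounded there while [(r / s)^N] tends to
   0. *)
have [s0 s1] : 0 < (1 + r) / 2 /\ (1 + r) / 2 < 1 by move: r0 r1; lra.
have rs : r < (1 + r) / 2 by move: r0 r1; lra.
set s := (1 + r) / 2 in s0 s1 rs.
have [B B0 hB] := ev_eta_comb_maj_le (ltW s0) s1.
apply: cvgn_complexP => e e0.
have rs0 : 0 <= r / s by rewrite divr_ge0 // ltW.
have rs1 : `|r / s| < 1 by rewrite ger0_norm // ltr_pdivrMr // mul1r.
(* [B] may be 0, so [e] is divided by [B + 1]. *)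
have B1 : 0 < B + 1 by rewrite ltr_wpDl.
have [N hN] := (cvgn_epsP _ _).1 (cvg_expr rs1) _ (divr_gt0 e0 B1).
exists N => n /hN; rewrite !sub0r !normrN => h.
apply: le_lt_trans (ev_maj_le (eta_comb_majP n) s0 (ltW rs) (eta_comb_low L_eq)) _.
rewrite ltcR; move: h; rewrite ltr_pdivlMr //; apply: le_lt_trans.
rewrite ger0_norm ?exprn_ge0 // ler_wpM2l ?exprn_ge0 //.
by rewrite (le_trans (hB n)) // lerDl.
Qed.

End Transfer.

(** * The relation with denominators cleared, and its quotient form *)

Definition eta_relation : seq (int * seq nat) :=
  [:: (1, [:: 1; 1; 6; 6; 6; 4; 8; 48]%N); (1, [:: 2; 2; 2; 12; 3; 3; 8; 48]%N);
      (- 2, [:: 1; 3; 16; 24; 24; 2; 4; 6]%N)].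

Lemma eta_relationE (A : comNzRingType) (x : nat -> A) :
  \sum_(t <- eta_relation) t.1%:~R * \prod_(k <- t.2) x k
  = (x 1%N ^+ 2 * x 6 ^+ 3 * x 4 * x 8 * x 48 + x 2 ^+ 3 * x 12 * x 3 ^+ 2 * x 8 * x 48)
    - 2 * (x 1%N * x 3 * x 16 * x 24 ^+ 2 * x 2 * x 4 * x 6).
Proof. by rewrite /eta_relation !big_cons !big_nil /= mulrNz; ring. Qed.

Lemma eta_relation_quotients (F : fieldType) (x : nat -> F) :
  (forall k, (0 < k)%N -> x k != 0) ->
  \sum_(t <- eta_relation) t.1%:~R * \prod_(k <- t.2) x k = 0 ->
  (x 1%N ^+ 2 * x 6) / (x 2 * x 3 ^+ 2) + (x 2 ^+ 2 * x 12) / (x 4 * x 6 ^+ 2)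
  = 2 * ((x 1%N * x 16 * x 24 ^+ 2) / (x 3 * x 6 * x 8 * x 48)).
Proof.
move=> x0; rewrite eta_relationE => /eqP; rewrite subr_eq0 => /eqP e.
have n2 := x0 2 isT; have n3 := x0 3 isT; have n4 := x0 4 isT; have n6 := x0 6 isT.
have n8 := x0 8 isT; have n48 := x0 48 isT.
transitivity ((x 1%N ^+ 2 * x 6 ^+ 3 * x 4 * x 8 * x 48
    + x 2 ^+ 3 * x 12 * x 3 ^+ 2 * x 8 * x 48)
  / (x 2 * x 3 ^+ 2 * x 4 * x 6 ^+ 2 * x 8 * x 48)).
  by field; rewrite n2 n3 n4 n6 n8 n48.
by rewrite e; field; rewrite n2 n3 n4 n6 n8 n48.
Qed.

Theorem lemma3p4 (R : realType) (q : R[i]) (hq : `|q| < 1) :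
  (f q 1 ^+ 2 * f q 6) / (f q 2 * f q 3 ^+ 2)
    + (f q 2 ^+ 2 * f q 12) / (f q 4 * f q 6 ^+ 2)
  = 2 * ((f q 1 * f q 16 * f q 24 ^+ 2) / (f q 3 * f q 6 * f q 8 * f q 48)).
Proof.
pose r := complex.Re `|q|.
have qr : `|q| = r%:C by rewrite /r normc_def.
have r1 : r < 1 by rewrite -ltcR -qr.
apply: (@eta_relation_quotients _ (f q)).
  by move=> k /(f_cvg qr r1)[].
apply: (eta_transfer qr r1) => //.
by rewrite eta_relationE eta_fps_identity subrr.
Qed.
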